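(* Let $d\ge1$, $\beta,\gamma\in(-1,\infty)^d$, $\beta\neq\gamma$, $\sigma_1,\sigma_2>0$, and $1\le p,q<\infty$. Let $U_1,U_2,V_1,V_2$ be strictly positive (up to a set of null measure) weights on $\mathbb{R}^d_+$ and, for a fixed $\lambda\in(0,1)$, put $$\alpha=\lambda\beta+(1-\lambda)\gamma,\qquad\sigma=\lambda\sigma_1+(1-\lambda)\sigma_2,\qquad U=U_1^\lambda U_2^{1-\lambda},\qquad V=V_1^\lambda V_2^{1-\lambda}.$$ Then boundedness of the operators $$\mathcal{I}^{\beta,\sigma_1}\colon L^p(U_1d\mu_\beta)\to L^q(V_1d\mu_\beta),\qquad \mathcal{I}^{\gamma,\sigma_2}\colon L^p(U_2d\mu_\gamma)\to L^q(V_2d\mu_\gamma)$$ implies boundedness of the operator $$\mathcal{I}^{\alpha,\sigma}\colon L^p(Ud\mu_\alpha)\to L^q(Vd\mu_\alpha).$$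
   Context: $\mathbb{R}^d_+=(0,\infty)^d$, $\mathbb{N}=\{0,1,\ldots\}$, $|k|=\sum k_i$, $|\alpha|=\sum\alpha_i$. A weight is a nonnegative measurable function on $\mathbb{R}^d_+$. For $\alpha\in(-1,\infty)^d$ let $\mu_\alpha(dx)=x_1^{2\alpha_1+1}\cdots x_d^{2\alpha_d+1}\,dx$ on $\mathbb{R}^d_+$; $L^p(Ud\mu_\alpha)$ is the Lebesgue space on $\mathbb{R}^d_+$ for the measure $U\,d\mu_\alpha$. The Laguerre functions of convolution type are $\ell_k^\alpha(x)=\prod_{i=1}^d\ell_{k_i}^{\alpha_i}(x_i)$, $k\in\mathbb{N}^d$, where $$\ell_{k_i}^{\alpha_i}(x_i)=\Big(\frac{2\Gamma(k_i+1)}{\Gamma(k_i+\alpha_i+1)}\Big)^{1/2}L_{k_i}^{\alpha_i}(x_i^2)e^{-x_i^2/2}$$ and $L_m^\nu$ is the Laguerre polynomial of degree $m$ and order $\nu$. Define $$G_t^{\alpha}(x,y)=\sum_{k\in\mathbb{N}^d}e^{-t(4|k|+2|\alpha|+2d)}\ell_k^\alpha(x)\ell_k^\alpha(y),\qquad \mathcal{K}^{\alpha,\sigma}(x,y)=\frac1{\Gamma(\sigma)}\int_0^\infty G_t^{\alpha}(x,y)t^{\sigma-1}\,dt,$$ $$\mathcal{I}^{\alpha,\sigma}f(x)=\int_{\mathbb{R}^d_+}\mathcal{K}^{\alpha,\sigma}(x,y)f(y)\,d\mu_\alpha(y),$$ the last one on the natural domain of functions $f$ for which the integral converges for a.e.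 $x\in\mathbb{R}^d_+$. Boundedness from $X$ to $Y$ means that $X$ is contained in the natural domain of the operator $T$ and $\|Tf\|_Y\le C\|f\|_X$ for all $f\in X$, with $C$ independent of $f$. *)

(* Defs.v *)
From HB Require Import structures.
From mathcomp Require Import all_boot all_order all_algebra.
From mathcomp Require Import all_classical all_reals all_analysis.
From mathcomp Require Import measurable_realfun.

Set Implicit Arguments.
Unset Strict Implicit.
Unset Printing Implicit Defensive.
Import Order.TTheory GRing.Theory Num.Theory.
Import numFieldNormedType.Exports.
Local Open Scope classical_set_scope.
Local Open Scope ring_scope.

Section lebesgue_measure_tuple.
Context (R : realType).

Definition tcons n (x : measurableTypeR R * n.-tuple R) : n.+1.-tuple R :=
  [tuple of (x.1 : R) :: x.2].

Definition tuncons n (x : n.+1.-tuple R) : measurableTypeR R * n.-tuple R :=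
  (thead x, [tuple of behead x]).

Lemma measurable_tcons n : measurable_fun setT (@tcons n).
Proof.
apply: (@measurable_cons _ _ (measurableTypeR R * n.-tuple R)%type R fst n snd).
  exact: measurable_fst.
exact: measurable_snd.
Qed.

Lemma measurable_tuncons n : measurable_fun setT (@tuncons n).
Proof.
apply/measurable_fun_pairP; split; last exact: measurable_behead.
exact: (@measurable_tnth _ R n.+1 ord0).
Qed.

Lemma tconsK n : cancel (@tcons n) (@tuncons n).
Proof. by move=> [x t]; congr pair; exact/val_inj. Qed.

Section step.
Context (n : nat) (m : {sigma_finite_measure set (n.-tuple R) -> \bar R}).

Definition lebesgue_step : set (n.+1.-tuple R) -> \bar R :=
  pushforward (@lebesgue_measure R \x m)%E (@tcons n).

Let step0 : lebesgue_step set0 = 0%E.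
Proof. by rewrite /lebesgue_step /pushforward preimage_set0 measure0. Qed.

Let step_ge0 A : (0 <= lebesgue_step A)%E.
Proof. exact: (measure_ge0 (@lebesgue_measure R \x m)%E). Qed.

Let step_sigma_additive : semi_sigma_additive lebesgue_step.
Proof.
have mpre A : measurable A -> measurable (@tcons n @^-1` A).
  by move=> mA; rewrite -[X in measurable X]setTI; exact: measurable_tcons.
move=> F mF tF mUF; rewrite /lebesgue_step /pushforward preimage_bigcup.
apply: (measure_semi_sigma_additive (s := (@lebesgue_measure R \x m)%E)).
- by move=> k; exact: mpre.
- apply/trivIsetP => /= i j _ _ ij; rewrite -preimage_setI.
  by move/trivIsetP : tF => /(_ _ _ _ _ ij) ->//; rewrite preimage_set0.
- by rewrite -preimage_bigcup; exact: mpre.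
Qed.

HB.instance Definition _ := isMeasure.Build _ _ _ lebesgue_step
  step0 step_ge0 step_sigma_additive.

Let step_sigma_finite : sigma_finite setT lebesgue_step.
Proof.
have /sigma_finiteP[F [FT ndF Foo]] := sigma_finiteT (@lebesgue_measure R).
have /sigma_finiteP[G [GT ndG Goo]] := sigma_finiteT m.
exists (fun k => @tuncons n @^-1` (F k `*` G k)).
  rewrite -preimage_bigcup (_ : \bigcup_k _ = setT) ?preimage_setT//.
  apply/seteqP; split => // -[x t] _.
  have [k _ Fk] : (\bigcup_k F k) x by rewrite -FT.
  have [l _ Gl] : (\bigcup_k G k) t by rewrite -GT.
  exists (maxn k l) => //; split => /=.
  - by move: x Fk; exact/subsetPset/ndF/leq_maxl.
  - by move: t Gl; exact/subsetPset/ndG/leq_maxr.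
move=> k; have [mF Fk] := Foo k; have [mG Gk] := Goo k; split.
  rewrite -[X in measurable X]setTI; apply: measurable_tuncons => //.
  exact: measurableX.
rewrite /lebesgue_step /pushforward -comp_preimage.
rewrite (_ : _ \o _ = id); last by apply/funext => x; exact: tconsK.
by rewrite preimage_id product_measure1E// lte_mul_pinfty// ge0_fin_numE.
Qed.

HB.instance Definition _ :=
  Measure_isSigmaFinite.Build _ _ _ lebesgue_step step_sigma_finite.
End step.

Fixpoint lebesgue_tuple n : {sigma_finite_measure set (n.-tuple R) -> \bar R} :=
  if n is n'.+1 then lebesgue_step (lebesgue_tuple n') else
  \d_([tuple] : 0.-tuple R).

Lemma lebesgue_tuple_box n (A : 'I_n -> set R) :
  (forall i, measurable (A i)) ->
  (lebesgue_tuple n [set x | forall i, A i (tnth x i)] =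
   \prod_(i < n) lebesgue_measure (A i))%E.
Proof.
elim: n A => [A _|n IH A mA].
  by rewrite big_ord0 /= diracE mem_set//= => -[].
rewrite big_ord_recl -IH// -product_measure1E//; last 2 first.
- exact: (mA ord0).
- rewrite (_ : mkset _ = \bigcap_(i in [set: 'I_n])
      ((@tnth n R ^~ i) @^-1` A (lift ord0 i))).
    apply: fin_bigcap_measurable => // i _.
    by rewrite -[X in measurable X]setTI; exact: measurable_tnth.
  by apply/seteqP; split => x /= h i *; exact: h.
rewrite /= /lebesgue_step /pushforward; congr (product_measure1 _ _ _).
apply/seteqP; split => -[x t] /=.
  move=> h; split; first by have := h ord0; rewrite tnth0.
  by move=> i; have := h (lift ord0 i); rewrite tnthS.
move=> [h0 h] i; case: (unliftP ord0 i) => [j ->|->].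
  by rewrite tnthS; exact: h.
by rewrite tnth0.
Qed.

End lebesgue_measure_tuple.

Section potential_operators.
Context (R : realType) (d : nat).
Implicit Types (x y : d.-tuple R) (f : d.-tuple R -> R).

Definition orthant : set (d.-tuple R) := [set x | forall i, 0 < tnth x i].

Lemma measurable_orthant : measurable orthant.
Proof.
rewrite (_ : orthant = \bigcap_(i in [set: 'I_d])
    ((@tnth d R ^~ i) @^-1` `]0, +oo[)).
  apply: fin_bigcap_measurable => // i _.
  rewrite -[X in measurable X]setTI.
  by apply: (@measurable_tnth _ R d i) => //; exact: measurable_itv.
apply/seteqP; split => x /= h i; first by move=> _ /=; rewrite in_itv/= h.
by have := h i I; rewrite /= in_itv/= andbT.
Qed.

(* Functions on the orthant are represented by functions on the whole space.
   Every measure below is concentrated on the orthant, so that their values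
   elsewhere play no role. *)
Record weight := Weight {
  weight_fun :> d.-tuple R -> R ;
  weight_measurable : measurable_fun orthant weight_fun ;
  weight_ge0 : forall x, orthant x -> 0 <= weight_fun x }.

Section weighted_measure.
Context (m : {measure set (d.-tuple R) -> \bar R}) (w : weight).

Definition wmeasure (A : set (d.-tuple R)) : \bar R :=
  (\int[m]_(x in A `&` orthant) (w x)%:E)%E.

Let wmeasure0 : wmeasure set0 = 0%E.
Proof. by rewrite /wmeasure set0I integral_set0. Qed.

Let wmeasure_ge0 A : (0 <= wmeasure A)%E.
Proof.
by apply: integral_ge0 => x [_ ox]; rewrite lee_fin weight_ge0.
Qed.

Let wmeasure_sigma_additive : semi_sigma_additive wmeasure.
Proof.
move=> F mF tF mUF; rewrite /wmeasure setI_bigcupl ge0_integral_bigcup//.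
- apply: is_cvg_ereal_nneg_natsum_cond => n _ _; exact: wmeasure_ge0.
- by move=> k; apply: measurableI => //; exact: measurable_orthant.
- apply/measurable_EFinP; apply: measurable_funS (weight_measurable w).
    exact: measurable_orthant.
  by rewrite -setI_bigcupl; exact: subIsetr.
- by rewrite -setI_bigcupl => x [_ ox]; rewrite lee_fin weight_ge0.
- exact: trivIset_setIr.
Qed.

HB.instance Definition _ := isMeasure.Build _ _ _ wmeasure
  wmeasure0 wmeasure_ge0 wmeasure_sigma_additive.
End weighted_measure.

Lemma geo_weight_measurable (lambda : R) (U1 U2 : weight) :
  measurable_fun orthant
    (fun x => U1 x `^ lambda * U2 x `^ (1 - lambda)).
Proof.
apply: measurable_funM.
  exact: (measurableT_comp (measurable_powR _)) (weight_measurable U1).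
exact: (measurableT_comp (measurable_powR _)) (weight_measurable U2).
Qed.

Lemma geo_weight_ge0 (lambda : R) (U1 U2 : weight) x : orthant x ->
  0 <= U1 x `^ lambda * U2 x `^ (1 - lambda).
Proof. by move=> _; rewrite mulr_ge0 ?powR_ge0. Qed.

Definition geo_weight (lambda : R) (U1 U2 : weight) : weight :=
  Weight (geo_weight_measurable lambda U1 U2)
         (@geo_weight_ge0 lambda U1 U2).

Lemma power_weight_measurable (alpha : d.-tuple R) :
  measurable_fun orthant
    (fun x => \prod_(i < d) tnth x i `^ (2 * tnth alpha i + 1)).
Proof.
apply: measurable_funTS; apply: measurable_prod => i _.
exact: (measurableT_comp (measurable_powR _)) (measurable_tnth i).
Qed.

Lemma power_weight_ge0 (alpha : d.-tuple R) x : orthant x ->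
  0 <= \prod_(i < d) tnth x i `^ (2 * tnth alpha i + 1).
Proof. by move=> _; apply: prodr_ge0 => i _; exact: powR_ge0. Qed.

Definition power_weight (alpha : d.-tuple R) : weight :=
  Weight (power_weight_measurable alpha) (@power_weight_ge0 alpha).

Definition laguerre_measure (alpha : d.-tuple R) :
    {measure set (d.-tuple R) -> \bar R} :=
  wmeasure (lebesgue_tuple R d) (power_weight alpha).

Definition gamma_fun (s : R) : R :=
  \int[lebesgue_measure]_(t in `]0, +oo[) (t `^ (s - 1) * expR (- t)).

(* L_m^nu = \sum_j (-1)^j binom(m + nu, m - j) 'X^j / j!, where
   binom(m + nu, m - j) = (nu + j + 1) ... (nu + m) / (m - j)!. *)
Definition laguerre (nu : R) (m : nat) : {poly R} :=
  \poly_(j < m.+1) ((-1) ^+ j * (\prod_(j.+1 <= i < m.+1) (nu + i%:R)) /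
                    ((m - j)`! * j`!)%N%:R).

Definition laguerre_fun1 (nu : R) (m : nat) (u : R) : R :=
  Num.sqrt (2 * gamma_fun (m%:R + 1) / gamma_fun (m%:R + nu + 1)) *
  (laguerre nu m).[u ^+ 2] * expR (- u ^+ 2 / 2).

Definition laguerre_fun (alpha : d.-tuple R) (k : d.-tuple nat) x : R :=
  \prod_(i < d) laguerre_fun1 (tnth alpha i) (tnth k i) (tnth x i).

(* The sum of an absolutely summable family; a junk value otherwise. *)
Definition usum (I : choiceType) (u : I -> R) : R :=
  fine (\esum_(i in [set: I]) (EFin \o u)^\+ i -
        \esum_(i in [set: I]) (EFin \o u)^\- i)%E.

Definition heat_kernel (alpha : d.-tuple R) (t : R) x y : R :=
  usum (fun k : d.-tuple nat =>
    expR (- t * (4 * (\sum_(i < d) tnth k i)%N%:R +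
                 2 * (\sum_(i < d) tnth alpha i) + 2 * d%:R)) *
    laguerre_fun alpha k x * laguerre_fun alpha k y).

(* Extended-real valued, as the integral diverges on the diagonal for small
   sigma. *)
Definition potential_kernel (alpha : d.-tuple R) (sigma : R) x y : \bar R :=
  ((gamma_fun sigma)^-1%:E * \int[lebesgue_measure]_(t in `]0%R, +oo[)
     (heat_kernel alpha t x y * t `^ (sigma - 1))%:E)%E.

Definition potential (alpha : d.-tuple R) (sigma : R) f x : \bar R :=
  (\int[laguerre_measure alpha]_(y in orthant)
     (potential_kernel alpha sigma x y * (f y)%:E))%E.

Definition potential_domain (alpha : d.-tuple R) (sigma : R) :
    set (d.-tuple R -> R) :=
  [set f | {ae lebesgue_tuple R d, forall x, orthant x ->
     (laguerre_measure alpha).-integrable orthant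
       (fun y => potential_kernel alpha sigma x y * (f y)%:E)%E}].

Definition bounded_operator (dom : set (d.-tuple R -> R))
    (T : (d.-tuple R -> R) -> d.-tuple R -> \bar R) (p q : R)
    (mX mY : {measure set (d.-tuple R) -> \bar R}) : Prop :=
  [set` Lfun mX p%:E] `<=` dom /\
  exists C : R, forall f, f \in Lfun mX p%:E ->
    measurable_fun orthant (T f) /\
    ('N[mY]_q%:E[T f] <= C%:E * 'N[mX]_p%:E[EFin \o f])%E.

Definition bounded_potential (alpha : d.-tuple R) (sigma p q : R)
    (U V : weight) : Prop :=
  bounded_operator (potential_domain alpha sigma) (potential alpha sigma) p q
    (wmeasure (laguerre_measure alpha) U) (wmeasure (laguerre_measure alpha) V).

Definition ae_positive (w : weight) : Prop :=
  {ae lebesgue_tuple R d, forall x, orthant x -> 0 < w x}.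

End potential_operators.

(* Main.v *)
(** The Laguerre functions obey the Hille-Hardy formula, which makes the
    one-dimensional heat kernel, as a function of the order [nu], a product of
    exponentials that are log-affine in [nu], of [1 / Gamma (nu + 1)], and of the
    power series [\sum_l (nu + 1)_l r^l / l!] and
    [\sum_j z^j / (j! (nu + 1)_j)] with [(a)_k] the rising factorial.  Up to a
    constant, each factor at
    [lambda beta + (1 - lambda) gamma] is at most the weighted geometric mean of
    the same factor at [beta] and at [gamma]: for the coefficients this is the
    log-convexity of Gamma and the inequality of arithmetic and geometric means,
    and Hoelder's inequality passes it on to sums.  Hoelder's inequality in the
    time variable then gives
      [K^{alpha,sigma} <= C (K^{beta,sigma1})^lambda (K^{gamma,sigma2})^(1-lambda)].
    A function [f] of the interpolated space factors as
    [|f| = f1^lambda f2^(1-lambda)] with [f1], [f2] in the two given spaces and of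
    the same norm as [f], and two more applications of Hoelder's inequality, in
    [y] and in [x], conclude. *)

Require Import Defs.
From mathcomp Require Import all_boot all_order all_algebra.
From mathcomp Require Import ring lra zify.
From mathcomp Require Import all_classical all_reals all_analysis.
From mathcomp Require Import measurable_realfun.

Set Implicit Arguments.
Unset Strict Implicit.
Unset Printing Implicit Defensive.
Import Order.TTheory GRing.Theory Num.Theory.
Import numFieldNormedType.Exports.
Import HBNNSimple.
Local Open Scope classical_set_scope.
Local Open Scope ring_scope.

(** * Rising factorials and real binomial coefficients *)

Section pochhammer.
Context (R : realFieldType).
Implicit Types (x nu u v : R) (a b i j k m n : nat).

(** The defining series of the heat kernel has terms of both signs, because Laguerre polynomials
    change sign, so Hoelder's inequality cannot be applied to it term by term; in the Hille-Hardy
    form every coefficient is positive. The formula itself is a rearrangement of one absolutely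
    summable family indexed by quadruples, and its algebraic content is the Pfaff-Saalschuetz sum.
    The two power series carry the rising factorial [(nu + 1)_k] in the numerator and in the
    denominator, hence need opposite inequalities. For a denominator the factorwise inequality of
    means suffices with constant 1; for a numerator it points the wrong way, and log-convexity of
    Gamma costs a quotient of Gamma values. What matters is that this quotient does not depend on
    [k], hence not on [t], [x], [y]. The measures [mu_beta], [mu_gamma], [mu_alpha] differ, so
    Hoelder's inequality in [y] and in [x] is used for Lebesgue measure, with densities for which
    the geometric mean is exact. Kernels may be infinite, so these estimates are made in extended
    nonnegative values with [0 * +oo = 0]. *)

Definition poch x k : R := \prod_(i < k) (x + i%:R).

(** The generalised binomial coefficient [x (x - 1) ... (x - k + 1) / k!], its falling factorial
    read from the small end as a rising one. *)
Definition rbin x k : R := poch (x - k%:R + 1) k / k`!%:R.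

Lemma poch0 x : poch x 0 = 1. Proof. by rewrite /poch big_ord0. Qed.

Lemma pochSr x k : poch x k.+1 = poch x k * (x + k%:R).
Proof. by rewrite /poch big_ord_recr. Qed.

Lemma pochSl x k : poch x k.+1 = x * poch (x + 1) k.
Proof.
rewrite /poch big_ord_recl /= addr0; congr (_ * _); apply: eq_bigr => i _.
by rewrite -addrA (_ : bump 0 i = i.+1)// -natr1 [1 + _]addrC.
Qed.

Lemma pochD x m n : poch x (m + n) = poch x m * poch (x + m%:R) n.
Proof.
elim: n => [|n IH]; first by rewrite addn0 poch0 mulr1.
by rewrite addnS !pochSr IH natrD addrA mulrA.
Qed.

Lemma poch_gt0 x k : 0 < x -> 0 < poch x k.
Proof.
by move=> x0; apply: prodr_gt0 => i _; rewrite (lt_le_trans x0)// lerDl.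
Qed.

Let fact_neq0 k : k`!%:R != 0 :> R.
Proof. by rewrite pnatr_eq0 -lt0n fact_gt0. Qed.

Lemma rbin0 x : rbin x 0 = 1. Proof. by rewrite /rbin poch0 fact0 divr1. Qed.

Lemma rbin_pascal x k : rbin (x + 1) k.+1 = rbin x k.+1 + rbin x k.
Proof.
rewrite /rbin (_ : x + 1 - k.+1%:R + 1 = x - k%:R + 1); last first.
  by rewrite -natr1; ring.
rewrite (_ : x - k.+1%:R + 1 = x - k%:R); last by rewrite -natr1; ring.
rewrite pochSr pochSl factS natrM -natr1.
have := fact_neq0 k; have : k%:R + 1 != 0 :> R by rewrite natr1 pnatr_eq0.
by move: (poch _ k) => p k0 f0; field; apply/andP.
Qed.

Lemma rbin_vandermonde x a b :
  rbin (x + a%:R) b = \sum_(i < b.+1) 'C(a, i)%:R * rbin x (b - i).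
Proof.
elim: a x b => [|a IH] x b.
  rewrite addr0 big_ord_recl bin0 mul1r subn0 big1 ?addr0// => i _.
  by rewrite lift0 bin0n mul0r.
case: b => [|b]; first by rewrite big_ord1 bin0 !rbin0 mul1r.
rewrite -natr1 addrA rbin_pascal !IH [in RHS]big_ord_recl bin0 subn0.
under [in RHS]eq_bigr => i _ do rewrite binS natrD mulrDl subSS.
rewrite big_split /= [X in X + _]big_ord_recl /= bin0 subn0 addrA.
congr (_ + _).
Qed.

Lemma rbin_split x p q :
  'C(p + q, q)%:R * rbin x (p + q) = rbin x p * rbin (x - p%:R) q.
Proof.
rewrite /rbin addnC pochD.
have -> : x - (q + p)%:R + 1 + q%:R = x - p%:R + 1 by rewrite natrD; ring.
have -> : x - (q + p)%:R + 1 = x - p%:R - q%:R + 1 by rewrite natrD; ring.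
have /(congr1 (fun n => n%:R : R)) := bin_fact (leq_addr p q).
rewrite addKn !natrM => <-.
have := fact_neq0 q; have := fact_neq0 p.
have : 'C(q + p, q)%:R != 0 :> R.
  by rewrite pnatr_eq0 -lt0n bin_gt0 leq_addr.
by move: (poch _ _) (poch _ _) => A B c0 y0 z0; field; apply/and3P.
Qed.

Lemma bin_bin a i m : ('C(a, i + m) * 'C(i + m, i) = 'C(a, i) * 'C(a - i, m))%N.
Proof.
have [ima|aim] := leqP (i + m) a; last first.
  rewrite (bin_small aim) mul0n; have [ia|ai] := leqP i a.
    by rewrite (@bin_small (a - i)) ?muln0//; lia.
  by rewrite (bin_small ai).
have ia : (i <= a)%N by lia.
have ami : (m <= a - i)%N by lia.
have fgt0 k : (0 < k`!)%N := fact_gt0 k.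
apply/eqP; rewrite -(eqn_pmul2r (fgt0 (i + m)%N)).
rewrite -(eqn_pmul2r (fgt0 i)) -(eqn_pmul2r (fgt0 m)).
rewrite -(eqn_pmul2r (fgt0 (a - (i + m))%N)); apply/eqP.
have h1 := bin_fact ima; have h2 := bin_fact (leq_addr m i).
have h3 := bin_fact ia; have h4 := bin_fact ami.
rewrite addKn in h2; rewrite -subnDA in h4.
transitivity (a`! * (i + m)`!)%N; first by rewrite -h1 -h2; ring.
by rewrite -h3 -h4; ring.
Qed.

(** Terms with [j < i] vanish, and [bin_bin] turns ['C(a, j) * 'C(j, i)] into
    ['C(a, i) * 'C(a - i, j - i)], which leaves the ordinary Vandermonde sum for
    [(a - i) + (n - a)]. *)
Lemma bin_vandermonde_shift n a b i : (i <= b)%N -> (a <= n)%N ->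
  (\sum_(j < b.+1) 'C(a, j) * 'C(j, i) * 'C(n - a, b - j) =
     'C(a, i) * 'C(n - i, b - i))%N.
Proof.
move=> ib an; have [ia|ai] := leqP i a; last first.
  rewrite (bin_small ai) mul0n big1// => j _.
  have [ja|aj] := leqP j a; last by rewrite (bin_small aj).
  by rewrite (bin_small (leq_ltn_trans ja ai)) muln0.
have -> : (n - i = (a - i) + (n - a))%N by lia.
rewrite -binomial.Vandermonde big_distrr /=.
rewrite -(big_mkord xpredT (fun j => 'C(a, j) * 'C(j, i) * 'C(n - a, b - j))%N).
rewrite (@big_cat_nat _ _ _ i)//=; last by lia.
rewrite big_nat_cond big1 ?add0n; last first.
  by move=> j /andP[/andP[_ ji] _]; rewrite (bin_small ji) muln0.
rewrite -{1}[i]add0n big_addn subSn// big_mkord; apply: eq_bigr => j _.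
by rewrite addnC bin_bin -mulnA subnDA.
Qed.

(* Three Chu-Vandermonde sums; this is the Pfaff-Saalschuetz identity. *)
Lemma pfaff_saalschuetz x n a b : (a <= n)%N -> (b <= n)%N ->
  \sum_(j < b.+1) 'C(a, j)%:R * 'C(n - a, b - j)%:R * rbin (x + n%:R + j%:R) n =
  rbin (x + n%:R) (n - b) * rbin (x + b%:R + a%:R) b.
Proof.
move=> an bn.
transitivity (\sum_(j < b.+1) \sum_(i < b.+1)
    ('C(a, j) * 'C(j, i) * 'C(n - a, b - j))%N%:R * rbin (x + n%:R) (n - i)).
  apply: eq_bigr => j _; rewrite rbin_vandermonde mulr_sumr.
  rewrite -(big_mkord xpredT (fun i => 'C(a, j)%:R * 'C(n - a, b - j)%:R *
    ('C(j, i)%:R * rbin (x + n%:R) (n - i)))).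
  rewrite (@big_cat_nat _ _ _ b.+1)//= big_mkord [X in _ + X = _]big_nat_cond
    [X in _ + X = _]big1 ?addr0.
    by apply: eq_bigr => i _; rewrite !natrM; ring.
  (* Here [j <= b < i], so ['C(j, i) = 0]: the expansion up to [n] may be cut at [b]. *)
  move=> i /andP[/andP[bi _] _]; rewrite (@bin_small j) ?mul0r ?mulr0//.
  by rewrite (leq_ltn_trans _ bi)// -ltnS.
rewrite exchange_big /= (rbin_vandermonde (x + b%:R)) mulr_sumr.
apply: eq_bigr => i _.
have ib : (i <= b)%N by rewrite -ltnS.
rewrite -mulr_suml -natr_sum bin_vandermonde_shift//.
rewrite natrM [in RHS]mulrCA -mulrA; congr (_ * _).
(* With [x + b] in this form, [rbin_split] extracts the factor [rbin (x + n) (n - b)], which does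
   not depend on [i]. *)
have -> : x + b%:R = x + n%:R - (n - b)%:R by rewrite natrB//; ring.
by rewrite -rbin_split (_ : n - b + (b - i) = n - i)%N//; lia.
Qed.

Lemma rbin_sub x a m : (a <= m)%N ->
  rbin (x + m%:R) (m - a) = poch (x + 1 + a%:R) (m - a) / (m - a)`!%:R.
Proof. by move=> am; rewrite /rbin natrB//; congr (poch _ _ / _); ring. Qed.

End pochhammer.

(** * The Hille-Hardy formula *)

Section laguerre_series.
Context (R : realType).
Implicit Types (nu r u v : R) (a b j m n : nat).

Lemma laguerre_hornerE nu m u : (laguerre nu m).[u] =
  \sum_(a < m.+1) (- u) ^+ a / a`!%:R * rbin (nu + m%:R) (m - a).
Proof.
rewrite horner_poly; apply: eq_bigr => -[a /=]; rewrite ltnS => am _.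
rewrite rbin_sub// natrM -[in RHS]mulN1r exprMn.
have -> : \prod_(a.+1 <= i < m.+1) (nu + i%:R) = poch (nu + 1 + a%:R) (m - a).
  rewrite /poch -[in LHS](add0n a.+1) big_addn subSS big_mkord.
  by apply: eq_bigr => i _; rewrite natrD -natr1; ring.
by rewrite invfM; ring.
Qed.

(* Summing this family over [(j, e, f, l)] first in [l] and then in [j], [e], [f]
   gives the closed form of the Hille-Hardy formula; summing it over the fibers of
   [hille_hardy_degree] gives its series in [r]. *)
Definition hille_hardy_term nu r u v (k : nat * nat * nat * nat) : R :=
  (u * v * r) ^+ k.1.1.1 / (k.1.1.1`!%:R * poch (nu + 1) k.1.1.1) *
  ((- (u * r)) ^+ k.1.1.2 / k.1.1.2`!%:R) * ((- (v * r)) ^+ k.1.2 / k.1.2`!%:R) *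
  (poch (nu + 1 + (k.1.1.1 + k.1.1.1 + k.1.1.2 + k.1.2)%:R) k.2 / k.2`!%:R *
   r ^+ k.2).

Definition hille_hardy_degree (k : nat * nat * nat * nat) : nat :=
  (k.1.1.1 + k.1.1.2 + k.1.2 + k.2)%N.

(* A triple [(a, b, j)] stands for the index [(j, a - j, b - j, n + j - a - b)] of
   degree [n], at which the term is a multiple of [u^a v^b]; [fiber_dom] ensures
   that no subtraction is truncated. *)
Definition fiber_dom n (t : 'I_n.+1 * 'I_n.+1 * 'I_n.+1) : bool :=
  [&& (t.2 <= t.1.1)%N, (t.2 <= t.1.2)%N & (t.1.1 + t.1.2 <= n + t.2)%N].

Definition fiber_map n (t : 'I_n.+1 * 'I_n.+1 * 'I_n.+1) :
    nat * nat * nat * nat :=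
  (t.2 : nat, t.1.1 - t.2, t.1.2 - t.2, n + t.2 - (t.1.1 + t.1.2))%N.

Lemma fiber_mapK n t : fiber_dom t -> hille_hardy_degree (@fiber_map n t) = n.
Proof.
move: t => [[a b] j] /and3P[/= ja jb abnj].
by rewrite /hille_hardy_degree/=; lia.
Qed.

Lemma fiber_map_inj n : {in @fiber_dom n &, injective (@fiber_map n)}.
Proof.
move=> [[a b] j] [[a' b'] j'] /and3P[/= ja jb _] /and3P[/= ja' jb' _] [jj ea eb _].
have -> : j = j' by exact: val_inj.
have -> : a = a' by apply: val_inj => /=; lia.
by have -> : b = b' by apply: val_inj => /=; lia.
Qed.

Lemma fiber_map_surj k :
  exists2 t, fiber_dom t & @fiber_map (hille_hardy_degree k) t = k.
Proof.
move: k => [[[j e] f] l]; rewrite /hille_hardy_degree/=.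
set n := (j + e + f + l)%N.
have je : (j + e < n.+1)%N by rewrite /n; lia.
have jf : (j + f < n.+1)%N by rewrite /n; lia.
have jn : (j < n.+1)%N by rewrite /n; lia.
exists (Ordinal je, Ordinal jf, Ordinal jn).
  by apply/and3P; split => /=; rewrite /n; lia.
by rewrite /fiber_map/=; congr (_, _, _, _); rewrite /n; lia.
Qed.

(** Everything that depends on [j] is collected in the last factor, so that the sum over [j] becomes
    the left-hand side of [pfaff_saalschuetz]. *)
Lemma hille_hardy_term_map nu r u v n (a b j : 'I_n.+1) : -1 < nu ->
  fiber_dom (a, b, j) ->
  hille_hardy_term nu r u v (fiber_map (a, b, j)) =
  (- u) ^+ a * (- v) ^+ b * r ^+ n * n`!%:R /
    (poch (nu + 1) (a + b) * a`!%:R * (n - a)`!%:R) *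
  ('C(a, j)%:R * 'C(n - a, b - j)%:R * rbin (nu + n%:R + j%:R) n).
Proof.
move=> nu1 /and3P[/= ja jb abnj]; rewrite /hille_hardy_term /fiber_map /=.
have fact_neq0 k : k`!%:R != 0 :> R by rewrite pnatr_eq0 -lt0n fact_gt0.
have poch_neq0 k : poch (nu + 1) k != 0 by rewrite gt_eqF// poch_gt0; lra.
have an : (a <= n)%N by rewrite -ltnS.
have bjna : (b - j <= n - a)%N by lia.
have -> : (j + j + (a - j) + (b - j) = a + b)%N by lia.
set l := (n + j - (a + b))%N.
have lE : (n - a - (b - j) = l)%N by rewrite /l; lia.
have h1 : a`!%:R = 'C(a, j)%:R * (j`!%:R * (a - j)`!%:R) :> R.
  by rewrite -!natrM bin_fact.
have h2 : (n - a)`!%:R = 'C(n - a, b - j)%:R * ((b - j)`!%:R * l`!%:R) :> R.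
  by rewrite -!natrM -lE bin_fact.
(* Both sides are [(nu + 1)_(j + n)], as [a + b + l = n + j]. *)
have h3 : poch (nu + 1) j * poch (nu + 1 + j%:R) n =
          poch (nu + 1) (a + b) * poch (nu + 1 + (a + b)%:R) l.
  by rewrite -!pochD; congr poch; rewrite /l; lia.
have -> : rbin (nu + n%:R + j%:R) n = poch (nu + 1 + j%:R) n / n`!%:R.
  by rewrite /rbin; congr (poch _ _ / _); ring.
have -> : poch (nu + 1 + j%:R) n =
    poch (nu + 1) (a + b) * poch (nu + 1 + (a + b)%:R) l / poch (nu + 1) j.
  by rewrite -h3 mulrC mulKf.
have -> : (- u) ^+ a * (- v) ^+ b * r ^+ n =
  (u * v * r) ^+ j * (- (u * r)) ^+ (a - j) * (- (v * r)) ^+ (b - j) * r ^+ l.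
  have /(congr1 (GRing.exp r)) -> : (n = j + (a - j) + (b - j) + l)%N.
    by rewrite /l; lia.
  have -> : u * v * r = (- u) * (- v) * r by ring.
  rewrite -!mulNr !exprMn !exprD -[in (- u) ^+ a](subnKC ja).
  rewrite -[in (- v) ^+ b](subnKC jb) !exprD.
  by ring.
have := bin_gt0 a j; rewrite ja => c1; have := bin_gt0 (n - a) (b - j).
rewrite bjna => c2; rewrite h1 h2.
have {}c1 : 'C(a, j)%:R != 0 :> R by rewrite pnatr_eq0 -lt0n.
have {}c2 : 'C(n - a, b - j)%:R != 0 :> R by rewrite pnatr_eq0 -lt0n.
have f1 := fact_neq0 j; have f2 := fact_neq0 (a - j)%N.
have f3 := fact_neq0 (b - j)%N; have f4 := fact_neq0 l; have f5 := fact_neq0 n.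
have p1 := poch_neq0 j; have p2 := poch_neq0 (a + b)%N.
move: (poch (nu + 1 + _) l) ((u * v * r) ^+ j) => P U.
move: (_ ^+ (a - j)) (_ ^+ (b - j)) (r ^+ l) => A B C.
field.
by rewrite c1 c2 f1 f2 f3 f4 f5 p1 p2.
Qed.

(** For fixed [a] and [b] the sum over [j] is evaluated by [pfaff_saalschuetz]; together with the
    prefactor, the result separates into the coefficients of [u^a] and of [v^b] in the two Laguerre
    polynomials. *)
Lemma sum_fiber nu r u v n : -1 < nu ->
  \sum_(t : 'I_n.+1 * 'I_n.+1 * 'I_n.+1 | fiber_dom t)
    hille_hardy_term nu r u v (fiber_map t) =
  r ^+ n * n`!%:R / poch (nu + 1) n * (laguerre nu n).[u] * (laguerre nu n).[v].
Proof.
move=> nu1; rewrite big_mkcond/=.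
rewrite -(pair_bigA _ (fun p (j : 'I_n.+1) => if fiber_dom (p, j) then
  hille_hardy_term nu r u v (fiber_map (p, j)) else 0)) /=.
rewrite -(pair_bigA _ (fun a b : 'I_n.+1 =>
  \sum_(j < n.+1) if fiber_dom (a, b, j) then
    hille_hardy_term nu r u v (fiber_map (a, b, j)) else 0)) /=.
rewrite !laguerre_hornerE -mulrA big_distrlr/= mulr_sumr; apply: eq_bigr => a _.
rewrite mulr_sumr; apply: eq_bigr => b _.
have an : (a <= n)%N by rewrite -ltnS.
have bn : (b <= n)%N by rewrite -ltnS.
pose K := (- u) ^+ a * (- v) ^+ b * r ^+ n * n`!%:R /
    (poch (nu + 1) (a + b) * a`!%:R * (n - a)`!%:R).
transitivity (K * \sum_(j < b.+1)
    'C(a, j)%:R * 'C(n - a, b - j)%:R * rbin (nu + n%:R + j%:R) n).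
  rewrite (big_ord_widen n.+1 (fun j => 'C(a, j)%:R * 'C(n - a, b - j)%:R *
    rbin (nu + n%:R + j%:R) n))//.
  rewrite [in RHS]big_mkcond mulr_sumr; apply: eq_bigr => j _; rewrite ltnS.
  case: ifPn => [D|nD].
    by rewrite hille_hardy_term_map//; case/and3P: D => _ ->.
  case: ifPn => jb; last by rewrite mulr0.
  have [ja|aj] := leqP j a; last by rewrite (bin_small aj) !mul0r mulr0.
  (* Here [a + b > n + j], that is [b - j > n - a], and the second binomial coefficient vanishes. *)
  rewrite (@bin_small (n - a)) ?mulr0 ?mul0r ?mulr0//.
  by move: nD; rewrite /fiber_dom/= ja jb/=; lia.
rewrite pfaff_saalschuetz// /K.
rewrite (rbin_sub nu an).
have -> : rbin (nu + b%:R + a%:R) b = poch (nu + 1 + a%:R) b / b`!%:R.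
  by rewrite /rbin; congr (poch _ _ / _); ring.
have fact_neq0 k : k`!%:R != 0 :> R by rewrite pnatr_eq0 -lt0n fact_gt0.
have poch_neq0 k : poch (nu + 1) k != 0 by rewrite gt_eqF// poch_gt0; lra.
have p1 := poch_neq0 a; have p2 := poch_neq0 (a + b)%N; have p3 := poch_neq0 n.
have pnE : poch (nu + 1) n = poch (nu + 1) a * poch (nu + 1 + a%:R) (n - a).
  by rewrite -pochD subnKC.
move: p2 p3; rewrite pnE pochD !mulf_eq0 !negb_or.
move=> /andP[_ p2] /andP[_ p3].
have f1 := fact_neq0 a; have f2 := fact_neq0 b; have f3 := fact_neq0 (n - a)%N.
move: (rbin _ _) (r ^+ n) (n`!%:R) => B C D.
move: ((- u) ^+ a) ((- v) ^+ b) => U V.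
field.
by rewrite f1 f2 f3 p1 p2 p3.
Qed.

End laguerre_series.

(** * Absolutely summable families *)

Section summed_families.
Context (R : realType).

(** Only one inequality needs an argument; the other is the same one for [c^-1] and the family
    [c * a]. *)
Lemma ge0_esumZl (I : choiceType) (a : I -> \bar R) (c : R) :
  (forall i, 0 <= a i)%E -> 0 <= c ->
  (\esum_(i in [set: I]) (c%:E * a i) = c%:E * \esum_(i in [set: I]) a i)%E.
Proof.
move=> a0; suff le (k : R) (b : I -> \bar R) : (forall i, 0 <= b i)%E -> 0 <= k ->
    (\esum_(i in [set: I]) (k%:E * b i) <= k%:E * \esum_(i in [set: I]) b i)%E.
  rewrite le_eqVlt => /predU1P[<-|c0].
    by rewrite mul0e esum1// => i _; rewrite mul0e.
  apply/eqP; rewrite eq_le le ?(ltW c0)//= -[leLHS]muleC.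
  rewrite -lee_pdivlMr// muleC.
  rewrite (le_trans _ (le c^-1 (fun i => c%:E * a i)%E _ _))//.
  - by apply: le_esum => i _; rewrite muleA -EFinM mulVf ?gt_eqF// mul1e.
  - by move=> i; rewrite mule_ge0// lee_fin ltW.
  - by rewrite invr_ge0 ltW.
move=> b0 k0; apply: ge_ereal_sup => _ [A [fA _] <-].
rewrite fsbig_finite//= -ge0_sume_distrr//.
rewrite lee_wpmul2l ?lee_fin//; apply: ereal_sup_ubound; exists A; first by split.
by rewrite fsbig_finite.
Qed.

(** Summability is part of the statement, because the total [P] is a real number. *)
Definition nnsummed (I : choiceType) (p : I -> R) (P : R) : Prop :=
  (forall i, 0 <= p i) /\ (\esum_(i in [set: I]) (p i)%:E = P%:E)%E.

Lemma nnsummed_uniq (I : choiceType) (p : I -> R) P Q :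
  nnsummed p P -> nnsummed p Q -> P = Q.
Proof. by move=> [_ e] [_]; rewrite e => -[]. Qed.

Lemma nnsummed_ge0 (I : choiceType) (p : I -> R) P : nnsummed p P -> 0 <= P.
Proof.
by move=> [p0 e]; rewrite -lee_fin -e esum_ge0// => i _; rewrite lee_fin.
Qed.

Lemma nnsummedD (I : choiceType) (p q : I -> R) P Q :
  nnsummed p P -> nnsummed q Q -> nnsummed (fun i => p i + q i) (P + Q).
Proof.
move=> [p0 pP] [q0 qQ]; split=> [i|]; first by rewrite addr_ge0.
rewrite EFinD -pP -qQ -esumD//; last 2 first.
- by move=> i _; rewrite lee_fin.
- by move=> i _; rewrite lee_fin.
Qed.

Lemma nnsummedZ (I : choiceType) (p : I -> R) P c : 0 <= c ->
  nnsummed p P -> nnsummed (fun i => c * p i) (c * P).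
Proof.
move=> c0 [p0 pP]; split=> [i|]; first by rewrite mulr_ge0.
by rewrite EFinM -pP -ge0_esumZl// => i; rewrite lee_fin.
Qed.

Lemma nnsummed_pair (I J : choiceType) (a : I -> R) (b : I -> J -> R) beta S :
  (forall i, 0 <= a i) -> (forall i, nnsummed (b i) (beta i)) ->
  nnsummed (fun i => a i * beta i) S ->
  nnsummed (fun k : I * J => a k.1 * b k.1 k.2) S.
Proof.
move=> a0 hb [_ hS]; split=> [k|]; first by rewrite mulr_ge0//; have [] := hb k.1.
rewrite -hS.
transitivity (\esum_(i in [set: I]) \esum_(j in [set: J]) (a i * b i j)%:E)%E.
  rewrite esum_esum; last first.
    by move=> i j _ _; rewrite lee_fin mulr_ge0//; have [] := hb i.
  by congr (esum _ _); apply/seteqP; split.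
apply: eq_esum => i _; have [_ <-] := nnsummedZ (a0 i) (hb i).
by [].
Qed.

Lemma nnsummed_bij (I J : choiceType) (h : I -> J) (p : J -> R) P :
  bijective h -> nnsummed p P <-> nnsummed (p \o h) P.
Proof.
move=> [g hg gh]; split=> -[p0 pP]; split.
- by move=> i /=.
- rewrite -pP [in RHS](reindex_esum [set: I] [set: J] h)//.
  by split=> // [x y _ _ /(can_inj hg)//|y _]; exists (g y).
- by move=> j; rewrite -[j]gh; exact: p0.
- rewrite -pP [LHS](reindex_esum [set: I] [set: J] h)//.
  by split=> // [x y _ _ /(can_inj hg)//|y _]; exists (g y).
Qed.

(** The fiber of [phi] over [n] is enumerated by the finite set [D n] through [g n]; the total is
    the iterated sum over the fibers. *)
Lemma nnsummed_fiber (K : choiceType) (T : nat -> finType)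
    (D : forall n, pred (T n)) (g : forall n, T n -> K) (phi : K -> nat) p P :
  (forall n t, D n t -> phi (g n t) = n) ->
  (forall n, {in D n &, injective (g n)}) ->
  (forall k, exists2 t, D (phi k) t & g (phi k) t = k) ->
  nnsummed p P -> nnsummed (fun n => \sum_(t | D n t) p (g n t)) P.
Proof.
move=> phig ginj gsurj [p0 pP]; split=> [n|]; first exact: sumr_ge0.
rewrite -pP.
transitivity (\esum_(n in [set: nat])
    \esum_(k in [set k | phi k = n]) (p k)%:E)%E; last first.
  rewrite -esum_bigcupT//; last first.
  - by move=> n m _ _ [k [/= <- <-]].
  by congr (esum _ _); apply/seteqP; split => // k _; exists (phi k).
apply: eq_esum => n _.
rewrite (reindex_esum [set` D n] [set k | phi k = n] (g n)); last first.
  split; first by move=> t /phig.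
  - by move=> s t /set_mem Ds /set_mem Dt; exact: ginj.
  - move=> k /= kn; move: kn (gsurj k); case: _ / => -[t Dt gt].
    by exists t.
rewrite esum_fset//; last by move=> i _; rewrite lee_fin.
rewrite -(@bigfs _ _ _ _ (index_enum (T n))) ?index_enum_uniq// ?sumEFin// => i _.
by rewrite mem_index_enum.
Qed.

Lemma nnsummed_series (p : nat -> R) P :
  nnsummed p P <-> (forall i, 0 <= p i) /\ series p @ \oo --> P.
Proof.
have serE : (fun n => (\sum_(0 <= k < n) (p k)%:E)%E) = EFin \o series p.
  by apply/funext => n; rewrite /= sumEFin.
split=> -[p0 h]; split=> //.
- apply: (@fine_cvg _ _ _ _ (EFin \o series p)); rewrite -serE -h.
  rewrite -(@nneseries_esumT _ (fun k => (p k)%:E)) => [|n]; last by rewrite lee_fin.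
  by apply: is_cvg_nneseries => n _ _; rewrite lee_fin.
- rewrite -(@nneseries_esumT _ (fun k => (p k)%:E)) => [|n]; last by rewrite lee_fin.
  rewrite serE; apply/cvg_lim => //; apply: cvg_EFin => //; exact: nearW.
Qed.

(* An arbitrary decomposition into nonnegative summable families replaces the
   positive and negative parts, which do not behave well under products. *)
Definition summed (I : choiceType) (u : I -> R) (s : R) : Prop :=
  exists p n P N, [/\ nnsummed p P, nnsummed n N,
    forall i, u i = p i - n i & s = P - N].

Lemma nnsummed_summable (I : choiceType) (p : I -> R) P :
  nnsummed p P -> summable setT (EFin \o p).
Proof.
move=> [p0 pP]; rewrite /summable (_ : esum _ _ = P%:E) ?ltry//.
by rewrite -pP; apply: eq_esum => i _; rewrite /= ger0_norm.
Qed.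

(** The value [P - N] does not depend on the decomposition: by [esumB] it agrees with the difference
    of the sums of the positive and negative parts, which is what [usum] computes. *)
Lemma summed_usum (I : choiceType) (u : I -> R) s : summed u s -> usum u = s.
Proof.
move=> [p [n [P [N [pP nN upn ->]]]]]; rewrite /usum.
have -> : EFin \o u = ((EFin \o p) \- (EFin \o n))%E.
  by apply/funext => i /=; rewrite upn.
have := esumB (nnsummed_summable pP) (nnsummed_summable nN).
move: pP nN => [p0 ->] [n0 ->] ->//.
- by move=> i _; rewrite lee_fin.
- by move=> i _; rewrite lee_fin.
Qed.

Lemma summed_nn (I : choiceType) (p : I -> R) P : nnsummed p P -> summed p P.
Proof.
move=> pP; exists p, (fun=> 0), P, 0; split => //; last by rewrite subr0.
- by split=> //; rewrite esum1.
- by move=> i; rewrite subr0.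
Qed.

Lemma summed_eq (I : choiceType) (u v : I -> R) s t : u =1 v -> s = t ->
  summed u s -> summed v t.
Proof. by move=> /funext -> ->. Qed.

Lemma summedZ (I : choiceType) (u : I -> R) s c :
  summed u s -> summed (fun i => c * u i) (c * s).
Proof.
move=> [p [n [P [N [pP nN upn ->]]]]]; have [c0|c0] := leP 0 c.
  exists (fun i => c * p i), (fun i => c * n i), (c * P), (c * N).
  by split; rewrite ?mulrBr//; [exact: nnsummedZ..|move=> i; rewrite upn mulrBr].
exists (fun i => - c * n i), (fun i => - c * p i), (- c * N), (- c * P).
have c0' : 0 <= - c by rewrite oppr_ge0 ltW.
by split; [exact: nnsummedZ..|move=> i; rewrite upn; ring|ring].
Qed.

(** The signs sit in [a] only. Each nonnegative part [p i] of [a i * beta i] is spread over [j] in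
    proportion to [b i j], with weight [p i / beta i]; this is where [beta i > 0] enters. *)
Lemma summed_pair (I J : choiceType) (a : I -> R) (b : I -> J -> R) beta S :
  (forall i, nnsummed (b i) (beta i)) -> (forall i, 0 < beta i) ->
  summed (fun i => a i * beta i) S ->
  summed (fun k : I * J => a k.1 * b k.1 k.2) S.
Proof.
move=> hb b0 [p [n [P [N [pP nN abpn ->]]]]].
exists (fun k => p k.1 / beta k.1 * b k.1 k.2),
  (fun k => n k.1 / beta k.1 * b k.1 k.2), P, N.
have aux (q : I -> R) Q : nnsummed q Q ->
    nnsummed (fun k : I * J => q k.1 / beta k.1 * b k.1 k.2) Q.
  move=> qQ; apply: (nnsummed_pair (a := fun i => q i / beta i) _ hb).
    by move=> i; rewrite divr_ge0 ?(ltW (b0 i))//; case: qQ.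
  rewrite (_ : (fun _ => _) = q)//; apply/funext => i.
  by rewrite divfK// gt_eqF.
split=> //; [exact: aux..|].
move=> [i j] /=; rewrite -mulrBl -mulrBl -abpn mulfK// gt_eqF//; exact: b0.
Qed.

Lemma nnsummedM (I J : choiceType) (p : I -> R) (q : J -> R) P Q :
  nnsummed p P -> nnsummed q Q -> nnsummed (fun k : I * J => p k.1 * q k.2) (P * Q).
Proof.
move=> pP qQ; apply: (nnsummed_pair (a := p) (b := fun=> q) (beta := fun=> Q)) => //.
  by case: pP.
rewrite mulrC (_ : (fun _ => _) = (fun i => Q * p i)).
  by apply: nnsummedZ => //; exact: nnsummed_ge0 qQ.
by apply/funext => i; rewrite mulrC.
Qed.

Lemma summedM (I J : choiceType) (u : I -> R) (v : J -> R) s t :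
  summed u s -> summed v t -> summed (fun k : I * J => u k.1 * v k.2) (s * t).
Proof.
move=> [p [n [P [N [pP nN upn ->]]]]] [p' [n' [P' [N' [pP' nN' vpn ->]]]]].
exists (fun k => p k.1 * p' k.2 + n k.1 * n' k.2),
  (fun k => p k.1 * n' k.2 + n k.1 * p' k.2), (P * P' + N * N'), (P * N' + N * P').
split; last by ring.
- by apply: nnsummedD; exact: nnsummedM.
- by apply: nnsummedD; exact: nnsummedM.
- by move=> [i j] /=; rewrite upn vpn; ring.
Qed.

Lemma summed_bij (I J : choiceType) (h : I -> J) (u : J -> R) s :
  bijective h -> summed (u \o h) s -> summed u s.
Proof.
move=> [g hg gh] [p [n [P [N [pP nN upn ->]]]]].
have bg : bijective g by exists h.
exists (p \o g), (n \o g), P, N; split => //.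
- exact/(nnsummed_bij p P bg).
- exact/(nnsummed_bij n N bg).
- by move=> j; rewrite /= -upn /= gh.
Qed.

Lemma summed_fiber (K : choiceType) (T : nat -> finType)
    (D : forall n, pred (T n)) (g : forall n, T n -> K) (phi : K -> nat) u s :
  (forall n t, D n t -> phi (g n t) = n) ->
  (forall n, {in D n &, injective (g n)}) ->
  (forall k, exists2 t, D (phi k) t & g (phi k) t = k) ->
  summed u s -> summed (fun n => \sum_(t | D n t) u (g n t)) s.
Proof.
move=> phig ginj gsurj [p [n [P [N [pP nN upn ->]]]]].
exists (fun m => \sum_(t | D m t) p (g m t)),
  (fun m => \sum_(t | D m t) n (g m t)), P, N.
split=> //; [exact: nnsummed_fiber phig _ _ _|exact: nnsummed_fiber phig _ _ _|].
by move=> m; rewrite -sumrB; apply: eq_bigr => t _; rewrite upn.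
Qed.

(** A series dominated by a convergent one is summed through [u = q - (q - u)], both terms being
    nonnegative. *)
Lemma summed_series (u q : nat -> R) (s Q : R) : (forall n, `|u n| <= q n) ->
  series q @ \oo --> Q -> series u @ \oo --> s -> summed u s.
Proof.
move=> uq qQ us; exists q, (fun n => q n - u n), Q, (Q - s); split.
- by apply/nnsummed_series; split => // n; rewrite (le_trans _ (uq n)).
- apply/nnsummed_series; split => [n|].
    by rewrite subr_ge0 (le_trans (ler_norm _)).
  rewrite (_ : series _ = series q \- series u); first exact: cvgB.
  by apply/funext => n; rewrite /series /= sumrB.
- by move=> n; ring.
- by ring.
Qed.

Lemma summed_expR (x : R) : summed (fun n => x ^+ n / n`!%:R) (expR x).
Proof.
apply: (@summed_series _ (exp_coeff `|x|) _ (expR `|x|)).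
- by move=> n; rewrite /exp_coeff/= normrM normrX normfV [X in _ / X]ger0_norm.
- exact: is_cvg_series_exp_coeff.
- exact: is_cvg_series_exp_coeff.
Qed.

Lemma summed_tuple d (a : 'I_d -> nat -> R) (s : 'I_d -> R) :
  (forall i, summed (a i) (s i)) ->
  summed (fun k : d.-tuple nat => \prod_(i < d) a i (tnth k i)) (\prod_(i < d) s i).
Proof.
elim: d a s => [|d IH] a s has_s.
  apply: summed_nn; split=> [k|]; first by rewrite big_ord0.
  rewrite (_ : [set: _] = [set [tuple]]); last first.
    by apply/seteqP; split => // k _; rewrite (tuple0 k).
  by rewrite esum_set1 ?big_ord0// lee_fin.
pose h (k : nat * d.-tuple nat) : d.+1.-tuple nat := [tuple of k.1 :: k.2].
apply: (@summed_bij _ _ h).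
  exists (fun k => (thead k, [tuple of behead k])).
    by move=> [k t]; congr pair; exact/val_inj.
  by move=> k; rewrite [RHS]tuple_eta; apply/val_inj.
rewrite big_ord_recl; apply: summed_eq (summedM (has_s ord0)
  (IH _ _ (fun i => has_s (lift ord0 i)))) => //.
move=> [k t] /=; rewrite [RHS]big_ord_recl /=; congr (_ * _).
by apply: eq_bigr => i _; rewrite tnthS.
Qed.

End summed_families.

(** * The closed form of the kernel *)

Section hille_hardy.
Context (R : realType).
Implicit Types (c : nat -> R) (a r u v x nu : R).

(* The absolute value makes all terms nonnegative for every [x], which gives
   measurability in [x] on the whole line. *)
Definition psum c x : R := fine (\sum_(0 <= k <oo) (c k * `|x| ^+ k)%:E)%E.

Lemma psum_nnsummed c x M : (forall k, 0 <= c k) -> 0 <= x ->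
  (forall n, \sum_(0 <= k < n) c k * x ^+ k <= M) ->
  nnsummed (fun k => c k * x ^+ k) (psum c x).
Proof.
move=> c0 x0 hM; have t0 k : 0 <= c k * x ^+ k by rewrite mulr_ge0 ?exprn_ge0.
split=> //; rewrite /psum ger0_norm//.
rewrite -(@nneseries_esumT _ (fun k => (c k * x ^+ k)%:E)) => [|n]; last first.
  by rewrite lee_fin.
rewrite fineK// ge0_fin_numE; last by apply: nneseries_ge0 => n _ _; rewrite lee_fin.
apply: (@le_lt_trans _ _ M%:E); last exact: ltry.
apply: lime_le; first by apply: is_cvg_nneseries => n _ _; rewrite lee_fin.
by apply: nearW => n; rewrite sumEFin lee_fin.
Qed.

Lemma nnsummed_shift (p : nat -> R) P : nnsummed p P ->
  nnsummed (fun n => if n is n'.+1 then p n' else 0) P.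
Proof.
move=> /nnsummed_series[p0 h]; apply/nnsummed_series; split=> [[|n]//|].
move: h; rewrite -[X in _ -> X]cvg_shiftS; apply: cvg_trans; apply: near_eq_cvg.
apply: nearW => n; rewrite /series /= big_nat_recl// add0r//.
Qed.

(** The coefficient of [r^k] in the binomial series of [(1 - r)^(-a)]; [psum (binom_coeff a) r]
    stands for that power when [0 <= r < 1]. *)
Definition binom_coeff a k : R := poch a k / k`!%:R.

Lemma binom_coeff_ge0 a k : 0 < a -> 0 <= binom_coeff a k.
Proof. by move=> a0; rewrite divr_ge0 ?ltW ?poch_gt0. Qed.

Lemma binom_coeffS a k :
  binom_coeff (a + 1) k.+1 = binom_coeff a k.+1 + binom_coeff (a + 1) k.
Proof.
rewrite /binom_coeff pochSr (pochSl a) factS natrM -natr1.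
have f0 : k`!%:R != 0 :> R by rewrite pnatr_eq0 -lt0n fact_gt0.
have k0 : k%:R + 1 != 0 :> R by rewrite natr1 pnatr_eq0.
by field; apply/andP.
Qed.

Lemma poch_le x y k : 0 < x -> x <= y -> poch x k <= poch y k.
Proof.
move=> x0 xy; apply: ler_prod => i _; rewrite lerD2r xy andbT.
by rewrite addr_ge0// ltW.
Qed.

(** The truncated form of [(1 - r) (1 - r)^(-a-1) = (1 - r)^(-a)]; the last term is what the
    truncation leaves over. *)
Lemma binom_partial_sum a r n :
  (1 - r) * \sum_(0 <= k < n.+1) binom_coeff (a + 1) k * r ^+ k =
  \sum_(0 <= k < n.+1) binom_coeff a k * r ^+ k - r ^+ n.+1 * binom_coeff (a + 1) n.
Proof.
elim: n => [|n IH].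
  by rewrite !big_nat1 /binom_coeff !poch0 fact0; field.
rewrite big_nat_recr//= mulrDr IH [in RHS]big_nat_recr//= binom_coeffS.
by rewrite (exprS r n.+1); ring.
Qed.

(** For natural [a], [binom_partial_sum] gives the bound [(1 - r)^(-a)] by induction; a real [a] is
    dominated coefficientwise by the larger integer [Num.bound a]. *)
Lemma binom_partial_bound a r : 0 < a -> 0 <= r < 1 ->
  exists M, forall n, \sum_(0 <= k < n) binom_coeff a k * r ^+ k <= M.
Proof.
move=> a0 /andP[r0 r1].
have q0 : 0 < 1 - r by rewrite subr_gt0.
have mono b n : 0 < b -> \sum_(0 <= k < n) binom_coeff b k * r ^+ k <=
    \sum_(0 <= k < n.+1) binom_coeff b k * r ^+ k.
  move=> b0; rewrite big_nat_recr//= lerDl mulr_ge0 ?exprn_ge0//.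
  exact: binom_coeff_ge0.
have nat_bound m n :
    \sum_(0 <= k < n.+1) binom_coeff m%:R k * r ^+ k <= (1 - r)^-1 ^+ m.
  elim: m n => [|m IH] n.
    rewrite big_nat_recl// big1 => [|k _]; last first.
      by rewrite /binom_coeff pochSl !mul0r.
    by rewrite /binom_coeff poch0 fact0 divr1 expr0 mulr1 addr0.
  rewrite exprS ler_pdivlMl// -natr1 binom_partial_sum (le_trans _ (IH n))//.
  by rewrite gerBl mulr_ge0 ?exprn_ge0// binom_coeff_ge0.
exists ((1 - r)^-1 ^+ (Num.bound a)) => n; apply: le_trans (nat_bound _ n).
apply: le_trans (mono _ _ a0) _; apply: ler_sum => k _.
rewrite ler_wpM2r ?exprn_ge0// ler_wpM2r ?invr_ge0// poch_le//.
by rewrite ltW// archi_boundP// ltW.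
Qed.

Lemma psum_binom a r : 0 < a -> 0 <= r < 1 ->
  nnsummed (fun k => binom_coeff a k * r ^+ k) (psum (binom_coeff a) r).
Proof.
move=> a0 r01; have [M hM] := binom_partial_bound a0 r01.
apply: psum_nnsummed hM; last by case/andP: r01.
by move=> k; exact: binom_coeff_ge0.
Qed.

Lemma psum_binom_gt0 a r : 0 < a -> 0 <= r < 1 -> 0 < psum (binom_coeff a) r.
Proof.
move=> a0 r01; have [r0 _] := andP r01.
have [t0 e] := psum_binom a0 r01; rewrite (lt_le_trans ltr01)// -lee_fin -e.
rewrite (esumID [set 0%N])/= ?setTI ?esum_set1.
- rewrite /binom_coeff poch0 fact0 divr1 expr0 mulr1 leeDl// esum_ge0// => i _.
  by rewrite lee_fin; exact: t0.
- by rewrite lee_fin; exact: t0.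
- by move=> i _; rewrite lee_fin; exact: t0.
Qed.

(** Pascal's rule for the coefficients reads [P = Q + r P] for the sums [P] at [a + 1] and [Q] at
    [a]; both being finite, it can be solved for [P]. *)
Lemma psum_binomS a r : 0 < a -> 0 <= r < 1 ->
  psum (binom_coeff (a + 1)) r = psum (binom_coeff a) r / (1 - r).
Proof.
move=> a0 r01; have [r0 r1] := andP r01.
have h1 := psum_binom (addr_gt0 a0 ltr01) r01.
have h2 := nnsummedD (psum_binom a0 r01) (nnsummedZ r0 (nnsummed_shift h1)).
have : psum (binom_coeff (a + 1)) r =
       psum (binom_coeff a) r + r * psum (binom_coeff (a + 1)) r.
  apply: nnsummed_uniq h1 _; congr (nnsummed _ _) : h2.
  apply/funext => -[|n].
    by rewrite mulr0 addr0 /binom_coeff !poch0.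
  by rewrite binom_coeffS exprS; ring.
move=> e; have q0 : 1 - r != 0 by rewrite subr_eq0 gt_eqF.
apply: (canRL (mulfK q0)); rewrite mulrBr mulr1 {1}e; ring.
Qed.

(** In [hille_hardy] the parameter of the inner series is [nu + 1 + m] with the integer
    [m = 2j + e + f]. *)
Lemma psum_binomD a r m : 0 < a -> 0 <= r < 1 ->
  psum (binom_coeff (a + m%:R)) r = psum (binom_coeff a) r * (1 - r)^-1 ^+ m.
Proof.
move=> a0 r01; elim: m => [|m IH]; first by rewrite addr0 expr0 mulr1.
rewrite -natr1 addrA psum_binomS ?IH ?exprSr ?mulrA//.
by rewrite (lt_le_trans a0)// lerDl.
Qed.

(** With these coefficients [psum] at [x > 0] is the hypergeometric function [0F1(; a; x)], that is
    [Gamma(a) x^((1-a)/2) I_(a-1)(2 sqrt x)] with the modified Bessel function [I]. *)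
Definition bessel_coeff a k : R := (k`!%:R * poch a k)^-1.

Lemma bessel_coeff_ge0 a k : 0 < a -> 0 <= bessel_coeff a k.
Proof. by move=> a0; rewrite invr_ge0 mulr_ge0// ltW// poch_gt0. Qed.

Lemma psum_bessel a x : 0 < a -> 0 <= x ->
  nnsummed (fun k => bessel_coeff a k * x ^+ k) (psum (bessel_coeff a) x).
Proof.
(* [(a)_0 = 1] and [(a)_(k+1) >= a], so [C] bounds every [1 / (a)_k] and the exponential series
   dominates. *)
move=> a0 x0; pose C := Num.max 1 a^-1.
apply: (@psum_nnsummed _ _ (C * expR x)) => // [k|n].
  exact: bessel_coeff_ge0.
have CP k : (poch a k)^-1 <= C.
  case: k => [|k]; first by rewrite poch0 invr1 le_max lexx.
  rewrite le_max pochSl invfM; apply/orP; right.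
  rewrite -[leRHS]mulr1 ler_wpM2l ?invr_ge0 ?(ltW a0)// invf_le1; last first.
    by rewrite poch_gt0// addr_gt0.
  apply: (@le_trans _ _ (\prod_(i < k) 1)); first by rewrite big1.
  apply: ler_prod => i _; rewrite ler01/= -addrA addrCA lerDl.
  by rewrite addr_ge0// ltW.
have C0 : 0 <= C by rewrite le_max ler01.
apply: (@le_trans _ _ (C * series (exp_coeff x) n)).
  rewrite /series /= mulr_sumr; apply: ler_sum => k _.
  rewrite /bessel_coeff /exp_coeff/= invfM mulrAC [leLHS]mulrC.
  rewrite [x ^+ k / _]mulrC ler_wpM2r ?CP// mulr_ge0 ?exprn_ge0 ?invr_ge0//.
rewrite ler_wpM2l//; apply: nondecreasing_cvgn_le; last first.
  exact: is_cvg_series_exp_coeff.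
apply: nondecreasing_series => k _ _.
by rewrite /exp_coeff mulr_ge0 ?exprn_ge0.
Qed.

(** The classical right-hand side of the formula: the first factor is [(1 - r)^(-nu-1)], the second
    the Bessel factor at [u v r / (1 - r)^2]. *)
Definition hille_hardy_kernel nu r u v : R :=
  psum (binom_coeff (nu + 1)) r *
  psum (bessel_coeff (nu + 1)) (u * v * r * ((1 - r)^-1 ^+ 2)) *
  expR (- ((u + v) * r / (1 - r))).

Lemma hille_hardy nu r u v : -1 < nu -> 0 <= r < 1 -> 0 <= u -> 0 <= v ->
  summed (fun n => r ^+ n * n`!%:R / poch (nu + 1) n *
                   (laguerre nu n).[u] * (laguerre nu n).[v])
         (hille_hardy_kernel nu r u v).
Proof.
move=> nu1 r01 u0 v0; have [r0 r1] := andP r01.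
have a0 : 0 < nu + 1 by rewrite -ltrBlDr sub0r.
pose q := (1 - r)^-1; have q0 : 0 < q by rewrite invr_gt0 subr_gt0.
have z0 : 0 <= u * v * r * q ^+ 2.
  by rewrite !mulr_ge0 ?exprn_ge0// ltW.
have bes := summed_nn (psum_bessel a0 z0).
have eu := summed_expR (- (u * r * q)).
have ev := summed_expR (- (v * r * q)).
have := summedZ (psum (binom_coeff (nu + 1)) r) (summedM (summedM bes eu) ev).
set S := (X in summed _ X) => hS.
(* The quadruples are grouped by degree: the fiber sums are the terms of the series in [r]. *)
apply: (@summed_eq _ _ _ _ S _ _ _
  (@summed_fiber _ _ _ (@fiber_dom) (@fiber_map) hille_hardy_degree
     (hille_hardy_term nu r u v) S fiber_mapK fiber_map_inj fiber_map_surj _)).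
- by move=> n /=; rewrite sum_fiber.
- rewrite /S /hille_hardy_kernel -!mulrA -expRD; congr (_ * (_ * expR _)).
  by rewrite /q; ring.
pose A (k : nat * nat * nat) : R :=
  (u * v * r) ^+ k.1.1 / (k.1.1`!%:R * poch (nu + 1) k.1.1) *
  ((- (u * r)) ^+ k.1.2 / k.1.2`!%:R) * ((- (v * r)) ^+ k.2 / k.2`!%:R).
pose b (k : nat * nat * nat) : R := nu + 1 + (k.1.1 + k.1.1 + k.1.2 + k.2)%:R.
have b0 k : 0 < b k by rewrite (lt_le_trans a0)// lerDl.
(* The sum over [l] is [psum (binom_coeff (nu + 1)) r] times [q^(2j + e + f)]; distributing the
   powers of [q] turns the rest into a Bessel series at [u v r q^2] and exponential series at
   [- u r q] and [- v r q]. *)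
apply: (summed_pair (a := A) (b := fun k l => binom_coeff (b k) l * r ^+ l)
  (beta := fun k => psum (binom_coeff (b k)) r)).
- by move=> k; exact: psum_binom.
- by move=> k; exact: psum_binom_gt0.
apply: summed_eq hS => // -[[j e] f] /=.
rewrite /A /b/= psum_binomD// -/q !exprD /bessel_coeff.
have -> : (u * v * r * q ^+ 2) ^+ j = (u * v * r) ^+ j * (q ^+ j * q ^+ j).
  by rewrite exprMn -exprM mulnC exprM expr2.
rewrite -[- (u * r * q)]mulNr -[- (v * r * q)]mulNr !(exprMn _ _ q).
by ring.
Qed.

End hille_hardy.

(** * Hoelder's inequality for geometric means *)

Section geometric_hoelder.
Context (R : realType).

Lemma amgm_powR (l x y : R) : 0 < l < 1 -> 0 <= x -> 0 <= y ->
  x `^ l * y `^ (1 - l) <= l * x + (1 - l) * y.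
Proof.
move=> /andP[l0 l1] x0 y0; have k0 : 0 < 1 - l by rewrite subr_gt0.
have := @conjugate_powR R (x `^ l) (y `^ (1 - l)) l^-1 (1 - l)^-1
  (powR_ge0 _ _) (powR_ge0 _ _).
rewrite !invr_gt0 !invrK => /(_ l0 k0); rewrite subrKC => /(_ erefl).
by rewrite -!powRrM !mulfV ?gt_eqF// !powRr1// [l * _]mulrC [(1 - l) * _]mulrC.
Qed.

Local Open Scope ereal_scope.

Lemma amgm_poweR (l A B : R) (x y : \bar R) : (0 < l < 1)%R -> (0 < A)%R ->
    (0 < B)%R -> 0 <= x -> 0 <= y ->
  x `^ l * y `^ (1 - l) <=
  (A `^ l * B `^ (1 - l))%:E * ((l / A)%:E * x + ((1 - l) / B)%:E * y).
Proof.
move=> l01 A0 B0; have /andP[l0 l1] := l01.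
have k0 : (0 < 1 - l)%R by rewrite subr_gt0.
have c0 : (0 < A `^ l * B `^ (1 - l))%R by rewrite mulr_gt0// powR_gt0.
have Aoo : (l / A)%:E * +oo = +oo by rewrite gt0_muley// lte_fin divr_gt0.
have Boo : ((1 - l) / B)%:E * +oo = +oo by rewrite gt0_muley// lte_fin divr_gt0.
case: x => [x| |]//; case: y => [y| |]//; rewrite ?lee_fin => x0 y0.
- have [x' x'0 ->] : exists2 x', (0 <= x')%R & x = (A * x')%R.
    by exists (x / A)%R; rewrite ?divr_ge0 ?(ltW A0)// mulrC divfK// gt_eqF.
  have [y' y'0 ->] : exists2 y', (0 <= y')%R & y = (B * y')%R.
    by exists (y / B)%R; rewrite ?divr_ge0 ?(ltW B0)// mulrC divfK// gt_eqF.
  rewrite !powRM ?(ltW A0) ?(ltW B0)// mulrACA ler_wpM2l ?(ltW c0)//.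
  by rewrite !mulrA !divfK ?gt_eqF// amgm_powR.
- by rewrite Boo addey// gt0_muley ?leey.
- by rewrite Aoo addye// gt0_muley ?leey.
- by rewrite Aoo Boo addye// gt0_muley ?leey.
Qed.

Lemma measurable_geo d (T : measurableType d) (D : set T) (f g : T -> \bar R)
    (l k : R) :
  measurable_fun D f -> measurable_fun D g ->
  measurable_fun D (fun x => f x `^ l * g x `^ k).
Proof.
by move=> mf mg; apply: emeasurable_funM;
  exact: measurableT_comp (measurable_poweR _) _.
Qed.

Lemma integral_geo_zero d (T : measurableType d) (mu : {measure set T -> \bar R})
    (D : set T) (f g : T -> \bar R) (l k : R) : measurable D -> l != 0%R ->
    measurable_fun D f -> measurable_fun D g ->
    (forall x, D x -> 0 <= f x) -> (forall x, D x -> 0 <= g x) ->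
    \int[mu]_(x in D) f x = 0 ->
  \int[mu]_(x in D) (f x `^ l * g x `^ k) = 0.
Proof.
move=> mD l0 mf mg f0 g0 intf.
have /ae_eq_integral_abs : \int[mu]_(x in D) `|f x| = 0.
  by rewrite -intf; apply: eq_integral => x /set_mem Dx; rewrite gee0_abs// f0.
move=> /(_ mD mf) fae.
rewrite (ge0_ae_eq_integral mD (measurable_geo _ _ mf mg) (measurable_cst 0))//.
- by rewrite integral0.
- by move=> x Dx; rewrite mule_ge0// poweR_ge0.
(* Where [f] vanishes so does its power, as [l != 0], and the product is [0] even if [g] is
   infinite. *)
- apply: filterS fae => x fx Dx; rewrite fx//=.
  by rewrite powR0// mul0e.
Qed.

(** Zero integrals are treated before infinite ones: if one integral vanishes, the right-hand side
    is [0] even against [+oo], and [integral_geo_zero] shows that the left-hand side vanishes too.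
    When both are positive and finite, the normalised inequality of means is integrated. *)
Lemma geo_hoelder d (T : measurableType d) (mu : {measure set T -> \bar R})
    (D : set T) (f g : T -> \bar R) (l : R) : measurable D -> (0 < l < 1)%R ->
    measurable_fun D f -> measurable_fun D g ->
    (forall x, D x -> 0 <= f x) -> (forall x, D x -> 0 <= g x) ->
  \int[mu]_(x in D) (f x `^ l * g x `^ (1 - l)) <=
  (\int[mu]_(x in D) f x) `^ l * (\int[mu]_(x in D) g x) `^ (1 - l).
Proof.
move=> mD l01 mf mg f0 g0; have /andP[l0 l1] := l01.
have k0 : (0 < 1 - l)%R by rewrite subr_gt0.
have If0 : 0 <= \int[mu]_(x in D) f x by exact: integral_ge0.
have Ig0 : 0 <= \int[mu]_(x in D) g x by exact: integral_ge0.
have [fz|fnz] := eqVneq (\int[mu]_(x in D) f x) 0.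
  rewrite integral_geo_zero ?gt_eqF//.
  by rewrite mule_ge0// poweR_ge0.
have [gz|gnz] := eqVneq (\int[mu]_(x in D) g x) 0.
  under eq_integral do rewrite muleC.
  rewrite integral_geo_zero ?gt_eqF//.
  by rewrite mule_ge0// poweR_ge0.
have f_gt0 : 0 < \int[mu]_(x in D) f x by rewrite lt0e fnz.
have g_gt0 : 0 < \int[mu]_(x in D) g x by rewrite lt0e gnz.
have [foo|ffin] := eqVneq (\int[mu]_(x in D) f x) +oo.
  rewrite foo poweRyr ?gt_eqF// gt0_mulye ?leey//.
  by rewrite poweR_gt0.
have [goo|gfin] := eqVneq (\int[mu]_(x in D) g x) +oo.
  rewrite goo [X in _ <= _ * X]poweRyr ?gt_eqF// gt0_muley ?leey//.
  by rewrite poweR_gt0.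
have /fineK fE : \int[mu]_(x in D) f x \is a fin_num by rewrite ge0_fin_numE// ltey.
have /fineK gE : \int[mu]_(x in D) g x \is a fin_num by rewrite ge0_fin_numE// ltey.
set A := fine _ in fE; set B := fine _ in gE; clearbody A B.
have A0 : (0 < A)%R by rewrite -lte_fin fE.
have B0 : (0 < B)%R by rewrite -lte_fin gE.
pose C := (A `^ l * B `^ (1 - l))%R.
have mf' : measurable_fun D (fun x => (l / A)%:E * f x) by exact: measurable_funeM.
have mg' : measurable_fun D (fun x => ((1 - l) / B)%:E * g x).
  exact: measurable_funeM.
have lA : (0 <= l / A)%R by rewrite divr_ge0 ?ltW.
have lB : (0 <= (1 - l) / B)%R by rewrite divr_ge0 ?ltW.
apply: (@le_trans _ _ (\int[mu]_(x in D)
    (C%:E * ((l / A)%:E * f x + ((1 - l) / B)%:E * g x)))).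
  apply: ge0_le_integral => //.
  - by move=> x Dx; rewrite mule_ge0// poweR_ge0.
  - exact: measurable_geo.
  - by apply: measurable_funeM; exact: emeasurable_funD.
  - by move=> x Dx; apply: amgm_poweR; rewrite ?f0 ?g0.
have C0 : (0 <= C)%R by rewrite mulr_ge0// powR_ge0.
rewrite ge0_integralZl//; last 2 first.
- exact: emeasurable_funD.
- by move=> x Dx; rewrite adde_ge0// mule_ge0 ?lee_fin ?f0 ?g0.
rewrite ge0_integralD//; last 2 first.
- by move=> x Dx; rewrite mule_ge0 ?lee_fin ?f0.
- by move=> x Dx; rewrite mule_ge0 ?lee_fin ?g0.
rewrite !ge0_integralZl//.
rewrite -fE -gE -[leLHS]/((C * (l / A * A + (1 - l) / B * B))%:E) lee_fin.
by rewrite !divfK ?gt_eqF// subrKC mulr1.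
Qed.

End geometric_hoelder.

Section series_hoelder.
Context (R : realType).

(** Hoelder's inequality for the counting measure, with [x^k = (x^k)^l (x^k)^(1-l)]: a comparison of
    coefficients passes to the sums. *)
Lemma psum_hoelder (a b c : nat -> R) (l C x A B G : R) : 0 < l < 1 -> 0 <= x ->
  0 <= C -> (forall k, 0 <= a k) -> (forall k, 0 <= b k) ->
  (forall k, c k <= C * (a k `^ l * b k `^ (1 - l))) ->
  nnsummed (fun k => a k * x ^+ k) A -> nnsummed (fun k => b k * x ^+ k) B ->
  nnsummed (fun k => c k * x ^+ k) G ->
  G <= C * (A `^ l * B `^ (1 - l)).
Proof.
move=> l01 x0 C0 a0 b0 cab [pa eA] [pb eB] [pc eG].
have := @geo_hoelder R _ nat counting setT (fun k => (a k * x ^+ k)%:E)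
  (fun k => (b k * x ^+ k)%:E) l measurableT l01.
rewrite !ge0_integral_count//; last first.
  by move=> k; rewrite mule_ge0// poweR_ge0.
rewrite !nneseries_esumT//; last first.
  by move=> k; rewrite mule_ge0// poweR_ge0.
rewrite eA eB => /(_ _ _ _ _)/= h.
rewrite -lee_fin -eG EFinM EFinM -!poweR_EFin.
apply: le_trans (lee_wpmul2l _ (h _ _ _ _)); rewrite ?lee_fin//; last 2 first.
- by move=> k _; rewrite lee_fin.
- by move=> k _; rewrite lee_fin.
rewrite -ge0_esumZl//; last by move=> k; rewrite mule_ge0// lee_fin powR_ge0.
apply: le_esum => k _; rewrite -!EFinM lee_fin.
rewrite !powRM ?exprn_ge0// mulrACA -powRD; last first.
  by rewrite subrKC oner_eq0.
by rewrite subrKC powRr1 ?exprn_ge0// mulrA ler_wpM2r ?exprn_ge0.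
Qed.

End series_hoelder.

(** * Integration against weighted measures *)

Section density.
Context (R : realType) (d : nat).
Local Open Scope ereal_scope.
Implicit Types (m : {measure set (d.-tuple R) -> \bar R}) (w : weight R d).

Let mO : measurable (@orthant R d) := @measurable_orthant R d.

Lemma measurable_weight w D : measurable D -> D `<=` @orthant R d ->
  measurable_fun D (fun x => (w x)%:E).
Proof.
move=> mD DO; apply/measurable_EFinP.
exact: measurable_funS DO (weight_measurable w).
Qed.

Lemma weightE_ge0 w x : @orthant R d x -> 0 <= (w x)%:E.
Proof. by move=> ox; rewrite lee_fin weight_ge0. Qed.

(** Both sides are monotone limits along simple approximations of [f]; on a level set of a simple
    function the identity is the definition of [wmeasure]. *)
Lemma integral_wmeasure m w (f : d.-tuple R -> \bar R) :
    measurable_fun (@orthant R d) f ->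
    (forall x, @orthant R d x -> 0 <= f x) ->
  \int[wmeasure m w]_(x in @orthant R d) f x =
  \int[m]_(x in @orthant R d) (f x * (w x)%:E).
Proof.
move=> mf f0; pose h := nnsfun_approx mO mf.
have mw := measurable_weight w mO (@subset_refl _ _).
have -> : \int[wmeasure m w]_(x in @orthant R d) f x =
    limn (fun n => \int[wmeasure m w]_(x in @orthant R d) (h n x)%:E).
  rewrite -monotone_convergence//=.
  - apply: eq_integral => x /[!inE] xD; apply/esym/cvg_lim => //=.
    exact: cvg_nnsfun_approx.
  - by move=> n; apply/measurable_EFinP/measurable_funTS.
  - by move=> n x _; rewrite lee_fin.
  - by move=> x _ a b ab; rewrite lee_fin//; exact/lefP/nd_nnsfun_approx.
have -> : \int[m]_(x in @orthant R d) (f x * (w x)%:E) =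
    limn (fun n => \int[m]_(x in @orthant R d) ((h n x)%:E * (w x)%:E)).
  rewrite -monotone_convergence//=.
  - apply: eq_integral => x /[!inE] xD; apply/esym/cvg_lim => //=.
    by apply: cvgeZr => //; exact: cvg_nnsfun_approx.
  - move=> n; apply: emeasurable_funM => //.
    by apply/measurable_EFinP/measurable_funTS.
  - by move=> n x ox; rewrite mule_ge0 ?lee_fin ?weight_ge0.
  - move=> x ox a b ab; rewrite lee_wpmul2r ?weightE_ge0// lee_fin.
    exact/lefP/nd_nnsfun_approx.
congr (limn _); apply/funext => n.
transitivity (\int[wmeasure m w]_(x in @orthant R d)
   (\sum_(y \in range (h n)) (y * \1_(h n @^-1` [set y]) x)%:E)).
  by apply: eq_integral => t tE; rewrite /= fimfunE -fsumEFin.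
have indich r : measurable_fun (@orthant R d)
    (fun x => (r * \1_(h n @^-1` [set r]) x)%:E).
  by apply: (measurable_comp measurableT) => //; exact: measurable_funM.
rewrite ge0_integral_fsum//; last by move=> y x ox; exact: nnfun_muleindic_ge0.
transitivity (\int[m]_(x in @orthant R d) (\sum_(y \in range (h n))
    (y * \1_(h n @^-1` [set y]) x)%:E * (w x)%:E)); last first.
  apply: eq_integral => x xE.
  rewrite -ge0_mule_fsuml => [|y]; last exact: nnfun_muleindic_ge0.
  by rewrite fsumEFin // -(fimfunE _ x).
rewrite ge0_integral_fsum//; last 2 first.
- by move=> y; apply: emeasurable_funM.
- by move=> y x ox; rewrite mule_ge0 ?weightE_ge0// nnfun_muleindic_ge0.
apply: eq_fsbigr => r rhn.
under [LHS]eq_integral do rewrite EFinM.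
rewrite integralZl_indic_nnsfun//.
under [RHS]eq_integral do rewrite EFinM -muleA.
have r0 : (0 <= r)%R by move: rhn; rewrite inE => -[t _ <-].
rewrite [RHS]ge0_integralZl//.
- congr (_ * _); rewrite integral_indic//= /wmeasure -setIA setIid setIC.
  rewrite integral_mkcondr; apply: eq_integral => x xE.
  by rewrite epatch_indic muleC.
- by apply: emeasurable_funM => //; apply/measurable_EFinP.
- by move=> x ox; rewrite mule_ge0 ?weightE_ge0// lee_fin.
Qed.

Lemma wmeasure_compl m w : wmeasure m w (~` @orthant R d) = 0.
Proof. by rewrite /wmeasure setICl integral_set0. Qed.

(** Norms integrate over the whole space, and the complement of the orthant is a null set of
    [wmeasure]. *)
Lemma integral_wmeasureT m w (f : d.-tuple R -> \bar R) :
    measurable_fun setT f -> (forall x, 0 <= f x) ->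
  \int[wmeasure m w]_x f x = \int[m]_(x in @orthant R d) (f x * (w x)%:E).
Proof.
move=> mf f0; rewrite -integral_wmeasure//; last exact: measurable_funTS.
rewrite (@ge0_negligible_integral _ _ _ _ _ (~` @orthant R d))//.
- by rewrite setTD setCK.
- exact: measurableC.
- exact: wmeasure_compl.
Qed.

End density.

(** * The Gamma function *)

Section gamma_function.
Context (R : realType).
Local Notation mu := (@lebesgue_measure R).
Implicit Types (s t u : R).

(** [gamma_fun] is [fine] of this integral, so the two can be identified only once finiteness is
    proved. *)
Definition egamma s : \bar R :=
  (\int[mu]_(t in `]0%R, +oo[) (t `^ (s - 1) * expR (- t))%:E)%E.

Lemma measurable_gamma_integrand s (D : set R) :
  measurable_fun D (fun t => (t `^ (s - 1) * expR (- t))%:E).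
Proof.
apply/measurable_EFinP/measurable_funTS; apply: measurable_funM.
  exact: measurable_powR.
exact: measurableT_comp.
Qed.

Lemma integral_expRN_ge u :
  (\int[mu]_(t in `]u, +oo[) (expR (- t))%:E = (expR (- u))%:E)%E.
Proof.
have cN : continuous (fun t : R => expR (- t)).
  move=> t; apply: continuous_comp; first exact: opp_continuous.
  exact: continuous_expR.
rewrite integral_itv_obnd_cbnd; last first.
  by apply/measurable_EFinP/measurable_funTS; exact: measurableT_comp.
rewrite (@ge0_continuous_FTC2y _ _ (fun t => - expR (- t)) _ 0).
- by rewrite EFinN oppeK add0e.
- by move=> t _; exact: expR_ge0.
- exact: continuous_subspaceT.
- by rewrite -oppr0; apply: cvgN; exact: cvgr_expR.
- by move=> t _; exact: ex_derive.
- by apply: cvgN; apply/cvg_at_right_filter; exact: cN.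
- move=> t _; rewrite derive1N// derive1_comp// derive1N// derive1_id mulrN1.
  by rewrite opprK derive1E; have /funeqP -> := @derive_expR R.
Qed.

Lemma powR_continuous_gt0 s t : 0 < t -> {for t, continuous (fun u : R => u `^ s)}.
Proof.
move=> t0; apply/differentiable_continuous/derivable1_diffP.
exact: (@ex_derive _ _ _ _ _ _ _ (is_derive1_powR s t0)).
Qed.

(** For [s < 1] the integrand is unbounded at [0], so the fundamental theorem of calculus is applied
    on [[a n, t]] with [a n = t / (n + 2)]; these intervals increase to []0, t]]. *)
Lemma integral_powR_lt s t : 0 < s -> 0 < t ->
  (\int[mu]_(u in `]0%R, t[) (s * u `^ (s - 1))%:E = (t `^ s)%:E)%E.
Proof.
move=> s0 t0; pose a n : R := t * harmonic n.+1.
have mf (D : set R) : measurable_fun D (fun u => (s * u `^ (s - 1))%:E).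
  apply/measurable_EFinP/measurable_funTS; exact: measurable_funM.
have a0 n : 0 < a n by rewrite mulr_gt0// /harmonic/= invr_gt0.
have at_ n : a n < t.
  by rewrite /a /harmonic/= gtr_pMr// invf_lt1// ltr1n.
have acvg : a @ \oo --> 0.
  rewrite -[X in _ --> X](mulr0 t); apply: cvgM; first exact: cvg_cst.
  by rewrite (cvg_shiftS (@harmonic R)); exact: cvg_harmonic.
rewrite integral_itv_bndo_bndc//.
have -> : `]0, t]%classic = \bigcup_n `[a n, t]%classic.
  apply/seteqP; split => [u /=|u [n _] /=]; rewrite !in_itv/=; last first.
    by move=> /andP[au ->]; rewrite (lt_le_trans (a0 n)).
  move=> /andP[u0 ut].
  have /cvgrPdist_lt/(_ u u0)[N _ /(_ N (leqnn _))] := acvg.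
  rewrite sub0r normrN gtr0_norm// => aNu.
  by exists N => //=; rewrite in_itv/= ut (ltW aNu).
have nd : {homo (fun n => `[a n, t]%classic) : n m / (n <= m)%N >-> (n <= m)%O}.
  move=> n m nm; apply/subsetPset => u /=; rewrite !in_itv/= => /andP[au ->].
  rewrite andbT (le_trans _ au)// ler_pM2l// lef_pV2 ?posrE//.
  by rewrite ler_nat.
have h := ge0_nondecreasing_set_cvg_integral (mu := mu) nd
  (fun n => measurable_itv `[a n, t]) (fun n => mf _).
apply: (cvg_unique _ (h _)) => // [n u|].
  by move=> _; rewrite lee_fin mulr_ge0 ?powR_ge0// ltW.
rewrite (_ : (fun n => _) = (fun n => (t `^ s)%:E - (a n `^ s)%:E)%E).
  suff : ((fun n => (t `^ s)%:E - (a n `^ s)%:E) @ \oo --> (t `^ s)%:E - 0)%E.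
    by rewrite sube0.
  apply: cvgeB => //; first exact: cvg_cst.
  apply: cvg_EFin; first exact: nearW.
  have /cvg_at_rightP := powR_cvg0 s0; apply; split => //.
apply/funext => n; apply: (@continuous_FTC2 _ _ (fun u => u `^ s)) => //.
- apply: derivable_within_continuous => u; rewrite in_itv/= => /andP[au _].
  have u0 : 0 < u := lt_le_trans (a0 n) au.
  apply: derivableM; first exact: derivable_cst.
  exact: (@ex_derive _ _ _ _ _ _ _ (is_derive1_powR _ u0)).
- split.
  + move=> u; rewrite in_itv/= => /andP[au _].
    exact: (@ex_derive _ _ _ _ _ _ _ (is_derive1_powR _ (lt_trans (a0 n) au))).
  + by apply: cvg_at_right_filter; exact: powR_continuous_gt0.
  + by apply: cvg_at_left_filter; exact: powR_continuous_gt0.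
- move=> u; rewrite in_itv/= => /andP[au _].
  by rewrite powR_derive1// in_itv/= andbT (lt_trans (a0 n)).
Qed.

(* Tonelli's theorem for [s u^(s-1) e^(-t)] on [0 < u < t]; no integrability is
   needed, so that finiteness can be deduced from this equation. *)
Lemma egammaS s : 0 < s -> egamma (s + 1) = (s%:E * egamma s)%E.
Proof.
move=> s0; pose K (p : R * R) : R :=
  if (0 < p.2) && (p.2 < p.1) then s * p.2 `^ (s - 1) * expR (- p.1) else 0.
have K0 p : (0 <= (K p)%:E)%E.
  rewrite lee_fin /K; case: ifP => // _.
  by rewrite !mulr_ge0 ?powR_ge0 ?expR_ge0// ltW.
have mK : measurable_fun setT
    (fun p : measurableTypeR R * measurableTypeR R => (K p)%:E).
  apply/measurable_EFinP; apply: measurable_fun_ifT => //.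
    by apply: measurable_and; exact: measurable_fun_ltr.
  apply: measurable_funM; first apply: measurable_funM => //.
    by exact: (measurableT_comp (measurable_powR _)).
  apply: measurableT_comp => //.
  by apply: measurable_funN; exact: measurable_fst.
have := fubini_tonelli (m1 := mu) (m2 := mu) _ mK K0.
have -> : (\int[mu]_t \int[mu]_u (K (t, u))%:E = egamma (s + 1))%E.
  rewrite /egamma [RHS]integral_mkcond; apply: eq_integral => t _.
  rewrite patchE; case: ifPn => [|].
    rewrite inE/= in_itv/= andbT => t0.
    rewrite addrK EFinM -integral_powR_lt//.
    rewrite muleC -ge0_integralZl//; last 2 first.
    - by apply/measurable_EFinP/measurable_funTS; exact: measurable_funM.
    - by move=> u _; rewrite lee_fin mulr_ge0 ?powR_ge0// ltW.
    rewrite [RHS]integral_mkcond; apply: eq_integral => u _.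
    rewrite patchE mem_setE in_itv/= /K/=.
    by case: ifP => // _; rewrite -EFinM mulrC.
  rewrite notin_setE/= in_itv/= andbT => /negP t0.
  rewrite integral0_eq// => u _; rewrite /K/=.
  case: ifP => // /andP[u0 ut]; exfalso; move: t0; rewrite (lt_trans u0 ut).
  by [].
move=> ->; rewrite /egamma -ge0_integralZl//; last 3 first.
- exact: measurable_gamma_integrand.
- by move=> u _; rewrite lee_fin mulr_ge0 ?powR_ge0 ?expR_ge0.
- by rewrite lee_fin ltW.
rewrite [RHS]integral_mkcond; apply: eq_integral => u _.
rewrite patchE; case: ifPn => [|].
  rewrite inE/= in_itv/= andbT => u0.
  rewrite -EFinM mulrA EFinM -integral_expRN_ge -ge0_integralZl//; last 2 first.
  - by apply/measurable_EFinP/measurable_funTS; exact: measurableT_comp.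
  - by rewrite lee_fin mulr_ge0 ?powR_ge0// ltW.
  rewrite [RHS]integral_mkcond; apply: eq_integral => t _.
  rewrite patchE mem_setE in_itv/= andbT /K/= u0/=.
  by case: ifP => // _; rewrite -EFinM.
rewrite notin_setE/= in_itv/= andbT => /negP u0.
rewrite integral0_eq// => t _; rewrite /K/=.
by case: ifP => // /andP[u1 _]; exfalso; move: u0; rewrite u1.
Qed.

Lemma egamma1 : egamma 1 = 1%E.
Proof.
rewrite /egamma; under eq_integral do rewrite subrr powRr0 mul1r.
by rewrite integral_expRN_ge oppr0 expR0.
Qed.

Lemma egamma_ge0 s : (0 <= egamma s)%E.
Proof.
by apply: integral_ge0 => t _; rewrite lee_fin mulr_ge0 ?powR_ge0 ?expR_ge0.
Qed.

Lemma egamma_nat n : (egamma n.+1%:R < +oo)%E.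
Proof.
elim: n => [|n IH]; first by rewrite egamma1 ltry.
by rewrite -natr1 egammaS// lte_mul_pinfty// lee_fin.
Qed.

(** [t^s <= 1 + t^(n+1)] bounds [egamma (s + 1)] by values at integers, finite by [egammaS]; the
    recursion then carries finiteness from [s + 1] down to [s], which avoids the singularity at
    [0]. *)
Lemma egamma_fin s : 0 < s -> (egamma s < +oo)%E.
Proof.
move=> s0; suff : (egamma (s + 1) < +oo)%E.
  rewrite egammaS//; case: (egamma s) (egamma_ge0 s) => [r _|//|//].
    by move=> _; exact: ltry.
  by rewrite gt0_muley ?lte_fin.
have [n sn] : exists n, s <= n.+1%:R.
  exists (Num.bound s).
  by rewrite ltW// (lt_trans (archi_boundP (ltW s0)))// ltr_nat.
apply: (@le_lt_trans _ _ (egamma 1 + egamma (n.+1%:R + 1))%E); last first.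
  by rewrite lte_add_pinfty// ?egamma1 ?ltry// natr1 egamma_nat.
rewrite /egamma -ge0_integralD//; last 4 first.
- by move=> t _; rewrite lee_fin mulr_ge0 ?powR_ge0 ?expR_ge0.
- exact: measurable_gamma_integrand.
- by move=> t _; rewrite lee_fin mulr_ge0 ?powR_ge0 ?expR_ge0.
- exact: measurable_gamma_integrand.
apply: ge0_le_integral => //.
- by move=> t _; rewrite lee_fin mulr_ge0 ?powR_ge0 ?expR_ge0.
- exact: measurable_gamma_integrand.
- by apply: emeasurable_funD; exact: measurable_gamma_integrand.
move=> t /=; rewrite in_itv/= andbT => t0.
rewrite -EFinD lee_fin -mulrDl ler_wpM2r ?expR_ge0// subrr powRr0 !addrK.
have [t1|t1] := leP t 1.
  rewrite (@le_trans _ _ 1) ?lerDl ?powR_ge0//.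
  have := @ge0_ler_powR R s (ltW s0) t 1.
  by rewrite !nnegrE powR1 (ltW t0) ler01; exact.
by rewrite (@le_trans _ _ (t `^ n.+1%:R)) ?lerDr// ler_powR// ltW.
Qed.

Lemma gamma_funE s : gamma_fun s = fine (egamma s).
Proof. by []. Qed.

Lemma egammaE s : 0 < s -> egamma s = (gamma_fun s)%:E.
Proof.
by move=> s0; rewrite gamma_funE fineK// ge0_fin_numE ?egamma_fin// egamma_ge0.
Qed.

Lemma gamma_funS s : 0 < s -> gamma_fun (s + 1) = s * gamma_fun s.
Proof.
by move=> s0; apply: EFin_inj; rewrite -egammaE ?addr_gt0// egammaS// EFinM egammaE.
Qed.

Lemma gamma_fun1 : gamma_fun 1 = 1 :> R.
Proof. by rewrite gamma_funE egamma1. Qed.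

Lemma gamma_fun_gt0 s : 0 < s -> 0 < gamma_fun s.
Proof.
move=> s0; rewrite lt0r -lee_fin -egammaE// egamma_ge0 andbT.
apply/eqP => g0; have : egamma s = 0%E by rewrite egammaE// g0.
rewrite /egamma => int0.
have : (\int[mu]_(t in `]0%R, +oo[) `|(t `^ (s - 1) * expR (- t))%:E| = 0)%E.
  rewrite -int0; apply: eq_integral => t _; rewrite gee0_abs// lee_fin.
  by rewrite mulr_ge0 ?powR_ge0 ?expR_ge0.
move=> /(ae_eq_integral_abs mu (measurable_itv _)
  (@measurable_gamma_integrand s `]0, +oo[)) [N [mN N0 sub]].
have : (mu `]0%R, 1%R[ <= mu N)%E.
  apply: le_measure; rewrite ?inE//.
  move=> t /=; rewrite in_itv/= => /andP[t0 _]; apply: sub => /=.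
  move=> /(_ _)/=; rewrite in_itv/= andbT => /(_ t0) [] /eqP.
  by rewrite gt_eqF// mulr_gt0 ?expR_gt0// powR_gt0.
by rewrite N0 lebesgue_measure_itv/= lte_fin ltr01 sube0 lee_fin ler10.
Qed.

Lemma gamma_fun_poch s k : 0 < s -> gamma_fun (s + k%:R) = poch s k * gamma_fun s.
Proof.
move=> s0; elim: k => [|k IH]; first by rewrite addr0 poch0 mul1r.
rewrite -natr1 addrA gamma_funS ?IH ?pochSr; first by ring.
by rewrite (lt_le_trans s0)// lerDl.
Qed.

Lemma gamma_fun_fact k : gamma_fun (k%:R + 1) = k`!%:R :> R.
Proof.
elim: k => [|k IH]; first by rewrite add0r gamma_fun1.
by rewrite gamma_funS// -natr1 IH factS natrM natr1.
Qed.

(** The Gamma integrand at the mean is pointwise the geometric mean of the two integrands, so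
    [geo_hoelder] applies. *)
Lemma gamma_fun_logconvex s t l : 0 < s -> 0 < t -> 0 < l < 1 ->
  gamma_fun (l * s + (1 - l) * t) <= gamma_fun s `^ l * gamma_fun t `^ (1 - l).
Proof.
move=> s0 t0 l01; have /andP[l0 l1] := l01.
have k0 : 0 < 1 - l by rewrite subr_gt0.
have st0 : 0 < l * s + (1 - l) * t by rewrite addr_gt0// mulr_gt0.
suff aux (a b c : R) : egamma s = a%:E -> egamma t = b%:E ->
    egamma (l * s + (1 - l) * t) = c%:E -> c <= a `^ l * b `^ (1 - l).
  by apply: aux; exact: egammaE.
move=> ea eb ec; rewrite -lee_fin EFinM -!poweR_EFin -ea -eb -ec.
have h := @geo_hoelder R _ _ mu `]0, +oo[%classic _ _ l (measurable_itv _) l01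
  (@measurable_gamma_integrand s _) (@measurable_gamma_integrand t _).
apply: le_trans (h _ _).
- rewrite le_eqVlt; apply/orP; left; apply/eqP.
  apply: eq_integral => u; rewrite inE/= in_itv/= andbT => u0.
  rewrite -EFinM !powRM ?powR_ge0 ?expR_ge0//; congr (_%:E).
  rewrite mulrACA -!powRrM -!expRM -expRD -powRD; last first.
    by rewrite (gt_eqF u0) implybT.
  by congr (_ `^ _ * expR _); ring.
- by move=> u _; rewrite lee_fin mulr_ge0 ?powR_ge0 ?expR_ge0.
- by move=> u _; rewrite lee_fin mulr_ge0 ?powR_ge0 ?expR_ge0.
Qed.

End gamma_function.

(** * Comparison of the kernels *)

Section geometric_mean.
Context (R : realType).
Implicit Types (l a b c x y : R).

Definition gmean l a b : R := a `^ l * b `^ (1 - l).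

Lemma gmean_ge0 l a b : 0 <= gmean l a b.
Proof. by rewrite mulr_ge0 ?powR_ge0. Qed.

Lemma gmean_gt0 l a b : 0 < a -> 0 < b -> 0 < gmean l a b.
Proof. by move=> a0 b0; rewrite mulr_gt0 ?powR_gt0. Qed.

Lemma gmeanM l a b x y : 0 <= a -> 0 <= b -> 0 <= x -> 0 <= y ->
  gmean l (a * x) (b * y) = gmean l a b * gmean l x y.
Proof. by move=> *; rewrite /gmean !powRM// mulrACA. Qed.

Lemma gmeanV l a b : 0 <= a -> 0 <= b -> gmean l a^-1 b^-1 = (gmean l a b)^-1.
Proof.
move=> a0 b0; rewrite /gmean -(powR_inv1 a0) -(powR_inv1 b0) -!powRrM !mulN1r.
by rewrite !powRN invfM.
Qed.

Lemma gmean_id l a : 0 <= a -> gmean l a a = a.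
Proof.
move=> a0; rewrite /gmean -powRD ?subrKC ?oner_eq0// ?implybT//.
by rewrite powRr1.
Qed.

Lemma gmean_expR l x y : gmean l (expR x) (expR y) = expR (l * x + (1 - l) * y).
Proof. by rewrite /gmean -!expRM -expRD [x * l]mulrC [y * _]mulrC. Qed.

Lemma gmean_powR l x s t : 0 < x ->
  gmean l (x `^ s) (x `^ t) = x `^ (l * s + (1 - l) * t).
Proof.
move=> x0; rewrite /gmean -!powRrM -powRD ?(gt_eqF x0) ?implybT//.
by rewrite [s * l]mulrC [t * _]mulrC.
Qed.

Lemma gmean_prod l (I : Type) (r : seq I) (a b : I -> R) :
  (forall i, 0 <= a i) -> (forall i, 0 <= b i) ->
  gmean l (\prod_(i <- r) a i) (\prod_(i <- r) b i) =
  \prod_(i <- r) gmean l (a i) (b i).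
Proof.
move=> a0 b0; elim: r => [|i r IH]; first by rewrite !big_nil gmean_id.
by rewrite !big_cons gmeanM ?IH// prodr_ge0.
Qed.

Lemma gmean_boundM l C D a b c x y z : 0 <= a -> 0 <= b -> 0 <= x -> 0 <= y ->
  0 <= c -> 0 <= z -> c <= C * gmean l a b -> z <= D * gmean l x y ->
  c * z <= C * D * gmean l (a * x) (b * y).
Proof. by move=> a0 b0 x0 y0 c0 z0 h k; rewrite gmeanM// mulrACA ler_pM. Qed.

End geometric_mean.

Section kernel_comparison.
Context (R : realType).
Implicit Types (a b l nu r t u v x y : R).

(** The inequality of means for each pair of factors [a + i], [b + i]; this direction serves rising
    factorials in denominators. *)
Lemma poch_gmean l a b k : 0 < l < 1 -> 0 < a -> 0 < b ->
  gmean l (poch a k) (poch b k) <= poch (l * a + (1 - l) * b) k.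
Proof.
move=> l01 a0 b0; rewrite /poch gmean_prod; last 2 first.
- by move=> i; rewrite addr_ge0// ltW.
- by move=> i; rewrite addr_ge0// ltW.
apply: ler_prod => i _; rewrite gmean_ge0/= (le_trans (amgm_powR l01 _ _))//.
- by rewrite addr_ge0// ltW.
- by rewrite addr_ge0// ltW.
- by rewrite le_eqVlt; apply/orP; left; apply/eqP; ring.
Qed.

(** The price of a rising factorial in a numerator: in [(c)_k = Gamma(c + k) / Gamma(c)],
    log-convexity bounds [Gamma(c + k)], and this quotient, independent of [k], is left over. *)
Definition gamma_ratio l a b : R :=
  gmean l (gamma_fun a) (gamma_fun b) / gamma_fun (l * a + (1 - l) * b).

Lemma lconv_gt0 l a b : 0 < l < 1 -> 0 < a -> 0 < b -> 0 < l * a + (1 - l) * b.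
Proof.
by move=> /andP[l0 l1] a0 b0; rewrite addr_gt0// mulr_gt0// subr_gt0.
Qed.

Lemma gamma_ratio_ge0 l a b : 0 < l < 1 -> 0 < a -> 0 < b -> 0 <= gamma_ratio l a b.
Proof.
move=> l01 a0 b0; rewrite divr_ge0 ?gmean_ge0// ltW// gamma_fun_gt0//.
exact: lconv_gt0.
Qed.

Lemma poch_le_gmean l a b k : 0 < l < 1 -> 0 < a -> 0 < b ->
  poch (l * a + (1 - l) * b) k <=
  gamma_ratio l a b * gmean l (poch a k) (poch b k).
Proof.
move=> l01 a0 b0; have c0 := lconv_gt0 l01 a0 b0.
have ge0 x : 0 < x -> 0 <= gamma_fun x by move=> ?; rewrite ltW// gamma_fun_gt0.
rewrite /gamma_ratio mulrAC -gmeanM ?ge0 ?(ltW (poch_gt0 _ _))//.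
rewrite ler_pdivlMr ?gamma_fun_gt0// [gamma_fun a * _]mulrC [gamma_fun b * _]mulrC.
rewrite -!gamma_fun_poch//.
have -> : l * a + (1 - l) * b + k%:R = l * (a + k%:R) + (1 - l) * (b + k%:R) by ring.
by apply: gamma_fun_logconvex => //; rewrite ltr_wpDr.
Qed.

Lemma psum_binom_gmean l a b r : 0 < l < 1 -> 0 < a -> 0 < b -> 0 <= r < 1 ->
  psum (binom_coeff (l * a + (1 - l) * b)) r <=
  gamma_ratio l a b * gmean l (psum (binom_coeff a) r) (psum (binom_coeff b) r).
Proof.
move=> l01 a0 b0 r01; have [r0 _] := andP r01; have c0 := lconv_gt0 l01 a0 b0.
apply: (psum_hoelder l01 r0 (gamma_ratio_ge0 l01 a0 b0) _ _ _
  (psum_binom a0 r01) (psum_binom b0 r01) (psum_binom c0 r01)).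
- by move=> k; exact: binom_coeff_ge0.
- by move=> k; exact: binom_coeff_ge0.
move=> k; rewrite -/(gmean _ _ _) /binom_coeff.
rewrite gmeanM ?invr_ge0 ?(ltW (poch_gt0 _ _))//.
rewrite gmean_id ?invr_ge0// mulrA ler_wpM2r ?invr_ge0//.
exact: poch_le_gmean.
Qed.

Lemma psum_bessel_gmean l a b x : 0 < l < 1 -> 0 < a -> 0 < b -> 0 <= x ->
  psum (bessel_coeff (l * a + (1 - l) * b)) x <=
  gmean l (psum (bessel_coeff a) x) (psum (bessel_coeff b) x).
Proof.
move=> l01 a0 b0 x0; have c0 := lconv_gt0 l01 a0 b0; rewrite -[leRHS]mul1r.
apply: (psum_hoelder l01 x0 ler01 _ _ _
  (psum_bessel a0 x0) (psum_bessel b0 x0) (psum_bessel c0 x0)).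
- by move=> k; exact: bessel_coeff_ge0.
- by move=> k; exact: bessel_coeff_ge0.
move=> k; rewrite mul1r -/(gmean _ _ _) /bessel_coeff.
have p0 y : 0 < y -> 0 < k`!%:R * poch y k.
  by move=> y0; rewrite mulr_gt0 ?poch_gt0// ltr0n fact_gt0.
rewrite gmeanV ?(ltW (p0 _ _))// lef_pV2 ?posrE ?gmean_gt0 ?p0//.
rewrite gmeanM ?(ltW (poch_gt0 _ _))// gmean_id// ler_wpM2l//.
exact: poch_gmean.
Qed.

Lemma psum_ge0 (c : nat -> R) x : (forall k, 0 <= c k) -> 0 <= psum c x.
Proof.
move=> c0; rewrite fine_ge0// nneseries_ge0// => k _ _.
by rewrite lee_fin mulr_ge0 ?exprn_ge0.
Qed.

Lemma hille_hardy_kernel_ge0 nu r u v : -1 < nu -> 0 <= hille_hardy_kernel nu r u v.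
Proof.
move=> nu1; have a0 : 0 < nu + 1 by rewrite -ltrBlDr sub0r.
rewrite !mulr_ge0 ?expR_ge0// psum_ge0// => k.
  exact: binom_coeff_ge0.
exact: bessel_coeff_ge0.
Qed.

Lemma hille_hardy_kernel_gmean l a b r u v : 0 < l < 1 -> -1 < a -> -1 < b ->
  0 <= r < 1 -> 0 <= u -> 0 <= v ->
  hille_hardy_kernel (l * a + (1 - l) * b) r u v <=
  gamma_ratio l (a + 1) (b + 1) *
  gmean l (hille_hardy_kernel a r u v) (hille_hardy_kernel b r u v).
Proof.
move=> l01 a1 b1 r01 u0 v0; have [r0 r1] := andP r01.
have a0 : 0 < a + 1 by rewrite -ltrBlDr sub0r.
have b0 : 0 < b + 1 by rewrite -ltrBlDr sub0r.
have c0 := lconv_gt0 l01 a0 b0.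
rewrite /hille_hardy_kernel.
have -> : l * a + (1 - l) * b + 1 = l * (a + 1) + (1 - l) * (b + 1) by ring.
set z := u * v * r * _.
have z0 : 0 <= z by rewrite !mulr_ge0 ?exprn_ge0// invr_ge0 subr_ge0 ltW.
(* One constant per factor: [gamma_ratio] for the binomial series, [1] for the Bessel series, and
   [1] for the exponential, which does not depend on the order. *)
rewrite -[gamma_ratio _ _ _]mulr1 -[_ * 1]mulr1.
have B0 c : 0 < c -> 0 <= psum (binom_coeff c) r.
  by move=> ?; apply: psum_ge0 => k; exact: binom_coeff_ge0.
have E0 c : 0 < c -> 0 <= psum (bessel_coeff c) z.
  by move=> ?; apply: psum_ge0 => k; exact: bessel_coeff_ge0.
apply: gmean_boundM; rewrite ?expR_ge0//; try by rewrite mulr_ge0 ?B0 ?E0.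
- apply: gmean_boundM; rewrite ?B0 ?E0//; first exact: psum_binom_gmean.
  by rewrite mul1r psum_bessel_gmean.
- by rewrite gmean_id ?expR_ge0// mul1r.
Qed.

(** The closed form of the one-dimensional heat kernel: Hille-Hardy at [r = e^(-4t)], [u = x^2],
    [v = y^2]. *)
Definition heat_kernel1 nu t x y : R :=
  expR (- t * (2 * nu + 2)) * (2 / gamma_fun (nu + 1)) *
  (expR (- x ^+ 2 / 2) * expR (- y ^+ 2 / 2)) *
  hille_hardy_kernel nu (expR (- t * 4)) (x ^+ 2) (y ^+ 2).

Let expR4 t : 0 < t -> 0 <= expR (- t * 4) < 1.
Proof. by move=> t0; rewrite expR_ge0/= expR_lt1 mulNr oppr_lt0 mulr_gt0. Qed.

Lemma heat_kernel1_ge0 nu t x y : -1 < nu -> 0 <= heat_kernel1 nu t x y.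
Proof.
move=> nu1; have a0 : 0 < nu + 1 by rewrite -ltrBlDr sub0r.
have G0 := gamma_fun_gt0 a0.
apply: mulr_ge0; last exact: hille_hardy_kernel_ge0.
by rewrite !mulr_ge0 ?expR_ge0// invr_ge0 ltW.
Qed.

(** One factor comes from the binomial series, the other from [1 / Gamma(nu + 1)], for which the
    comparison is an equality. *)
Definition heat_const l a b : R := gamma_ratio l (a + 1) (b + 1) ^+ 2.

Lemma heat_kernel1_gmean l a b t x y : 0 < l < 1 -> -1 < a -> -1 < b -> 0 < t ->
  heat_kernel1 (l * a + (1 - l) * b) t x y <=
  heat_const l a b * gmean l (heat_kernel1 a t x y) (heat_kernel1 b t x y).
Proof.
move=> l01 a1 b1 t0; rewrite /heat_kernel1.
have a0 : 0 < a + 1 by rewrite -ltrBlDr sub0r.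
have b0 : 0 < b + 1 by rewrite -ltrBlDr sub0r.
have g0 (z : R) : 0 < z -> 0 < gamma_fun z by exact: gamma_fun_gt0.
have i0 (z : R) : 0 < z -> 0 <= 2 / gamma_fun z.
  by move=> ?; rewrite divr_ge0// ltW// g0.
have e1 (p z : R) : 0 < z -> 0 <= expR p * (2 / gamma_fun z).
  by move=> ?; rewrite mulr_ge0 ?i0 ?expR_ge0.
have e2 (p q w z : R) : 0 < z ->
    0 <= expR p * (2 / gamma_fun z) * (expR q * expR w).
  by move=> ?; rewrite mulr_ge0 ?e1// mulr_ge0 ?expR_ge0.
pose k := gamma_ratio l (a + 1) (b + 1).
have cE : l * a + (1 - l) * b + 1 = l * (a + 1) + (1 - l) * (b + 1) by ring.
have c0 : 0 < l * a + (1 - l) * b + 1 by rewrite cE lconv_gt0.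
have c1 : -1 < l * a + (1 - l) * b by rewrite -ltrBlDr sub0r in c0.
have -> : heat_const l a b = 1 * k * 1 * k by rewrite /heat_const -/k; ring.
apply: gmean_boundM; try exact: hille_hardy_kernel_ge0; rewrite ?e2//.
- apply: gmean_boundM; rewrite ?e1//; try by rewrite mulr_ge0 ?expR_ge0.
  + apply: gmean_boundM; rewrite ?expR_ge0 ?i0//.
      rewrite mul1r gmean_expR le_eqVlt; apply/orP; left; apply/eqP.
      by congr expR; ring.
    rewrite gmeanM ?invr_ge0 ?(ltW (g0 _ _))// gmean_id// gmeanV ?(ltW (g0 _ _))//.
    rewrite /k /gamma_ratio -cE le_eqVlt; apply/orP; left; apply/eqP.
    have /gt_eqF := gmean_gt0 l (g0 _ a0) (g0 _ b0); have /gt_eqF := g0 _ c0.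
    by move=> /negbT ? /negbT ?; field; apply/andP.
  + by rewrite gmean_id ?mul1r// mulr_ge0 ?expR_ge0.
- exact: hille_hardy_kernel_gmean (expR4 t0) (sqr_ge0 _) (sqr_ge0 _).
Qed.

(** The squared normalising constant of [laguerre_fun1] is [2 / Gamma(nu + 1)] times
    [n! / (nu + 1)_n], the weight in [hille_hardy]. *)
Lemma summed_laguerre nu t x y : -1 < nu -> 0 < t ->
  summed (fun n => expR (- t * (4 * n%:R + 2 * nu + 2)) *
                   laguerre_fun1 nu n x * laguerre_fun1 nu n y)
         (heat_kernel1 nu t x y).
Proof.
move=> nu1 t0; have a0 : 0 < nu + 1 by rewrite -ltrBlDr sub0r.
have := summedZ (expR (- t * (2 * nu + 2)) * (2 / gamma_fun (nu + 1)) *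
  (expR (- x ^+ 2 / 2) * expR (- y ^+ 2 / 2)))
  (hille_hardy nu1 (expR4 t0) (sqr_ge0 x) (sqr_ge0 y)).
apply: summed_eq => // n; rewrite /laguerre_fun1.
have -> : n%:R + nu + 1 = nu + 1 + n%:R by ring.
rewrite gamma_fun_poch// gamma_fun_fact.
have P0 : 0 < poch (nu + 1) n by rewrite poch_gt0.
have G0 := gamma_fun_gt0 a0.
set c := Num.sqrt _.
have cc : c * c = 2 * n`!%:R / (poch (nu + 1) n * gamma_fun (nu + 1)).
  by rewrite -expr2 sqr_sqrtr// divr_ge0// mulr_ge0// ltW.
have -> : expR (- t * (4 * n%:R + 2 * nu + 2)) =
          expR (- t * (2 * nu + 2)) * expR (- t * 4) ^+ n.
  by rewrite -expRM_natr -expRD; congr expR; ring.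
move: cc; move: c => c cc.
transitivity ((c * c) * (expR (- t * (2 * nu + 2)) * expR (- t * 4) ^+ n *
  (laguerre nu n).[x ^+ 2] * (laguerre nu n).[y ^+ 2] *
  expR (- x ^+ 2 / 2) * expR (- y ^+ 2 / 2))); last by ring.
rewrite cc invfM; ring.
Qed.

End kernel_comparison.

(** * Measurability of the one-dimensional heat kernel *)

Section measurability.
Context (R : realType).

(** Writing [1 / x] as [x] times a power of [x^2] reduces the claim to [powR]; at [0] both sides are
    [0]. *)
Lemma measurable_invr : measurable_fun setT (fun x : R => x^-1).
Proof.
rewrite (_ : (fun x => _) = (fun x => x * (x ^+ 2) `^ (-1))).
  apply: measurable_funM => //.
  by apply: (measurableT_comp (measurable_powR _)); exact: measurable_funX.
apply/funext => x; rewrite powR_inv1 ?sqr_ge0//.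
have [->|x0] := eqVneq x 0; first by rewrite mul0r invr0.
by rewrite expr2 invfM mulrA divff// mul1r.
Qed.

Lemma measurable_psum (c : nat -> R) : (forall k, 0 <= c k) ->
  measurable_fun setT (psum c).
Proof.
move=> c0; apply: measurableT_comp; first exact: fine_measurable.
apply: ge0_emeasurable_sum.
  by move=> k x _ _; rewrite lee_fin mulr_ge0// exprn_ge0.
move=> k _; apply/measurable_EFinP; apply: measurable_funM => //.
by apply: measurable_funX; exact: normr_measurable.
Qed.

Lemma measurable_heat_kernel1 disp (T : measurableType disp) (nu : R)
    (f g h : T -> R) : -1 < nu -> measurable_fun setT f ->
    measurable_fun setT g -> measurable_fun setT h ->
  measurable_fun setT (fun q => heat_kernel1 nu (f q) (g q) (h q)).
Proof.
move=> nu1 mf mg mh; have a0 : 0 < nu + 1 by rewrite -ltrBlDr sub0r.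
have mE (k : T -> R) : measurable_fun setT k ->
    measurable_fun setT (fun q => expR (k q)).
  by move=> mk; exact: measurableT_comp.
have mI (k : T -> R) : measurable_fun setT k ->
    measurable_fun setT (fun q => (k q)^-1).
  by move=> mk; apply: measurableT_comp => //; exact: measurable_invr.
have mNf : measurable_fun setT (fun q => - f q) by exact: measurable_funN.
have mg2 := measurable_funX 2 mg; have mh2 := measurable_funX 2 mh.
have mr : measurable_fun setT (fun q => expR (- f q * 4)).
  by apply: mE; apply: measurable_funM.
have mq : measurable_fun setT (fun q => (1 - expR (- f q * 4))^-1).
  by apply: mI; apply: measurable_funB.
apply: measurable_funM; first apply: measurable_funM.
- by apply: measurable_funM => //; apply: mE; exact: measurable_funM.
- by apply: measurable_funM; apply: mE; apply: measurable_funM => //;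
    exact: measurable_funN.
apply: measurable_funM; first apply: measurable_funM.
- apply: measurableT_comp mr; apply: measurable_psum => k.
  exact: binom_coeff_ge0.
- apply: measurableT_comp.
    by apply: measurable_psum => k; exact: bessel_coeff_ge0.
  apply: measurable_funM; last exact: measurable_funX.
  by apply: measurable_funM => //; exact: measurable_funM.
- apply: mE; apply: measurable_funN; apply: measurable_funM => //.
  by apply: measurable_funM => //; exact: measurable_funD.
Qed.

End measurability.

Lemma gmean_poweR (R : realType) (l a b : R) (X Y : \bar R) :
  0 <= a -> 0 <= b -> (0 <= X)%E -> (0 <= Y)%E ->
  ((a%:E * X) `^ l * (b%:E * Y) `^ (1 - l) =
   (gmean l a b)%:E * (X `^ l * Y `^ (1 - l)))%E.
Proof.
move=> a0 b0 X0 Y0; rewrite (poweRM _ _ X0) ?lee_fin// (poweRM _ _ Y0) ?lee_fin//.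
by rewrite muleACA !poweR_EFin -EFinM.
Qed.

(** * Heat and potential kernels in several variables *)

Section potential_kernels.
Context (R : realType) (d : nat).
Implicit Types (alpha beta gam : d.-tuple R) (x y : d.-tuple R) (t s l : R).
Local Notation mu := (@lebesgue_measure R).

Definition heat_prod alpha t x y : R :=
  \prod_(i < d) heat_kernel1 (tnth alpha i) t (tnth x i) (tnth y i).

Lemma heat_prod_ge0 alpha t x y : (forall i, -1 < tnth alpha i) ->
  0 <= heat_prod alpha t x y.
Proof. by move=> a1; apply: prodr_ge0 => i _; exact: heat_kernel1_ge0. Qed.

(** The multi-index series factors over the coordinates, the exponent being a sum over [i]; absolute
    summability in each coordinate makes [usum] the product. *)
Lemma heat_kernelE alpha t x y : (forall i, -1 < tnth alpha i) -> 0 < t ->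
  heat_kernel alpha t x y = heat_prod alpha t x y.
Proof.
move=> a1 t0; apply: summed_usum.
apply: summed_eq (summed_tuple (fun i =>
  summed_laguerre (tnth x i) (tnth y i) (a1 i) t0)) => // k.
rewrite /laguerre_fun !big_split/=; congr (_ * _ * _).
rewrite -expR_sum; congr expR; rewrite -mulr_sumr; congr (_ * _).
rewrite !big_split/= natr_sum -!mulr_sumr; congr (_ + _).
by rewrite sumr_const card_ord; ring.
Qed.

Definition lconv_tuple l beta gam : d.-tuple R :=
  [tuple l * tnth beta i + (1 - l) * tnth gam i | i < d].

Lemma lconv_tuple_gtN1 l beta gam : 0 < l < 1 ->
  (forall i, -1 < tnth beta i) -> (forall i, -1 < tnth gam i) ->
  forall i, -1 < tnth (lconv_tuple l beta gam) i.
Proof.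
move=> l01 b1 g1 i; rewrite tnth_mktuple.
have b0 : 0 < tnth beta i + 1 by rewrite -ltrBlDr sub0r.
have g0 : 0 < tnth gam i + 1 by rewrite -ltrBlDr sub0r.
by have := lconv_gt0 l01 b0 g0; lra.
Qed.

Definition heat_prod_const l beta gam : R :=
  \prod_(i < d) heat_const l (tnth beta i) (tnth gam i).

Lemma heat_prod_const_ge0 l beta gam : 0 <= heat_prod_const l beta gam.
Proof. by apply: prodr_ge0 => i _; exact: sqr_ge0. Qed.

Lemma heat_prod_gmean l beta gam t x y : 0 < l < 1 ->
  (forall i, -1 < tnth beta i) -> (forall i, -1 < tnth gam i) -> 0 < t ->
  heat_prod (lconv_tuple l beta gam) t x y <=
  heat_prod_const l beta gam * gmean l (heat_prod beta t x y) (heat_prod gam t x y).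
Proof.
move=> l01 b1 g1 t0; rewrite /heat_prod gmean_prod; last 2 first.
- by move=> i; exact: heat_kernel1_ge0.
- by move=> i; exact: heat_kernel1_ge0.
rewrite -big_split/=; apply: ler_prod => i _.
rewrite heat_kernel1_ge0; last exact: lconv_tuple_gtN1.
by rewrite tnth_mktuple/= heat_kernel1_gmean.
Qed.

Lemma potential_kernelE alpha s x y : (forall i, -1 < tnth alpha i) ->
  potential_kernel alpha s x y = ((gamma_fun s)^-1%:E *
    \int[mu]_(t in `]0%R, +oo[) (heat_prod alpha t x y * t `^ (s - 1))%:E)%E.
Proof.
move=> a1; congr (_ * _)%E; apply: eq_integral => t.
by rewrite inE/= in_itv/= andbT => t0; rewrite heat_kernelE.
Qed.

Lemma potential_kernel_ge0 alpha s x y : (forall i, -1 < tnth alpha i) -> 0 < s ->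
  (0 <= potential_kernel alpha s x y)%E.
Proof.
move=> a1 s0; rewrite potential_kernelE// mule_ge0//.
  by rewrite lee_fin invr_ge0 ltW// gamma_fun_gt0.
by apply: integral_ge0 => t _; rewrite lee_fin mulr_ge0 ?heat_prod_ge0 ?powR_ge0.
Qed.

Lemma measurable_heat_prod disp (T : measurableType disp) alpha
    (f : T -> R) (g h : T -> d.-tuple R) : (forall i, -1 < tnth alpha i) ->
    measurable_fun setT f -> measurable_fun setT g -> measurable_fun setT h ->
  measurable_fun setT (fun q => heat_prod alpha (f q) (g q) (h q)).
Proof.
move=> a1 mf mg mh; apply: measurable_prod => i _.
apply: measurable_heat_kernel1 => //.
- exact: (measurableT_comp (measurable_tnth i) mg).
- exact: (measurableT_comp (measurable_tnth i) mh).
Qed.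

Lemma measurable_potential_integrand alpha s x y (D : set R) :
  (forall i, -1 < tnth alpha i) ->
  measurable_fun D (fun t => (heat_prod alpha t x y * t `^ (s - 1))%:E).
Proof.
move=> a1; apply/measurable_EFinP/measurable_funTS; apply: measurable_funM.
  by apply: measurable_heat_prod.
exact: measurable_powR.
Qed.

Lemma measurable_potential_kernel alpha s : (forall i, -1 < tnth alpha i) ->
  measurable_fun setT (fun p : d.-tuple R * d.-tuple R =>
    potential_kernel alpha s p.1 p.2).
Proof.
(* Extension by [0] to [t <= 0] makes the time integral a section integral over the whole line, to
   which Tonelli's theorem applies. *)
move=> a1; pose G (q : (d.-tuple R * d.-tuple R) * measurableTypeR R) : \bar R :=
  (if 0 < q.2 then heat_prod alpha q.2 q.1.1 q.1.2 * q.2 `^ (s - 1) else 0)%:E.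
have G0 q : (0 <= G q)%E.
  rewrite /G lee_fin; case: ifP => // _.
  by rewrite mulr_ge0 ?heat_prod_ge0 ?powR_ge0.
have mG : measurable_fun setT G.
  apply/measurable_EFinP; apply: measurable_fun_ifT => //.
    by apply: measurable_fun_ltr => //; exact: measurable_snd.
  apply: measurable_funM.
    apply: measurable_heat_prod => //.
    - by apply: measurableT_comp measurable_fst; exact: measurable_fst.
    - by apply: measurableT_comp measurable_fst; exact: measurable_snd.
  exact: (measurableT_comp (measurable_powR _)).
rewrite (_ : (fun p => _) = (fun p => (gamma_fun s)^-1%:E * fubini_F mu G p)%E).
  by apply: measurable_funeM; exact: measurable_fun_fubini_tonelli_F.
apply/funext => p; rewrite potential_kernelE//; congr (_ * _)%E.
rewrite integral_mkcond; apply: eq_integral => t _.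
rewrite patchE mem_setE in_itv/= andbT /G/=.
by case: ifP.
Qed.

(** [gamma_ratio l s1 s2] compensates the factors [1 / gamma_fun] that normalise the three potential
    kernels. *)
Definition potential_const l beta gam s1 s2 : R :=
  heat_prod_const l beta gam * gamma_ratio l s1 s2.

Lemma potential_const_ge0 l beta gam s1 s2 : 0 < l < 1 -> 0 < s1 -> 0 < s2 ->
  0 <= potential_const l beta gam s1 s2.
Proof. by move=> *; rewrite mulr_ge0 ?heat_prod_const_ge0 ?gamma_ratio_ge0. Qed.

Lemma potential_kernel_gmean l beta gam s1 s2 x y : 0 < l < 1 ->
  (forall i, -1 < tnth beta i) -> (forall i, -1 < tnth gam i) -> 0 < s1 -> 0 < s2 ->
  (potential_kernel (lconv_tuple l beta gam) (l * s1 + (1 - l) * s2) x y <=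
   (potential_const l beta gam s1 s2)%:E *
   (potential_kernel beta s1 x y `^ l * potential_kernel gam s2 x y `^ (1 - l)))%E.
Proof.
move=> l01 b1 g1 s10 s20; have a1 := lconv_tuple_gtN1 l01 b1 g1.
have s0 := lconv_gt0 l01 s10 s20.
rewrite !potential_kernelE//.
set Ia := (\int[mu]_(t in _) _)%E; set Ib := (\int[mu]_(t in _) _)%E.
set Ig := (\int[mu]_(t in _) _)%E.
have [G1 G2 G] : [/\ 0 < gamma_fun s1, 0 < gamma_fun s2 &
    0 < gamma_fun (l * s1 + (1 - l) * s2)] by split; exact: gamma_fun_gt0.
have Ib0 : (0 <= Ib)%E.
  by apply: integral_ge0 => t _; rewrite lee_fin mulr_ge0 ?heat_prod_ge0 ?powR_ge0.
have Ig0 : (0 <= Ig)%E.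
  by apply: integral_ge0 => t _; rewrite lee_fin mulr_ge0 ?heat_prod_ge0 ?powR_ge0.
have key : (Ia <= (heat_prod_const l beta gam)%:E * (Ib `^ l * Ig `^ (1 - l)))%E.
  have h := @geo_hoelder R _ _ mu `]0, +oo[%classic _ _ l (measurable_itv _) l01
    (@measurable_potential_integrand beta s1 x y _ b1)
    (@measurable_potential_integrand gam s2 x y _ g1).
  apply: le_trans (lee_wpmul2l _ (h _ _)); last first.
  - by move=> t _; rewrite lee_fin mulr_ge0 ?heat_prod_ge0 ?powR_ge0.
  - by move=> t _; rewrite lee_fin mulr_ge0 ?heat_prod_ge0 ?powR_ge0.
  - by rewrite lee_fin heat_prod_const_ge0.
  rewrite -ge0_integralZl//; last 3 first.
  - by apply: measurable_geo; exact: measurable_potential_integrand.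
  - by move=> t _; rewrite mule_ge0// poweR_ge0.
  - by rewrite lee_fin heat_prod_const_ge0.
  apply: ge0_le_integral => //.
  - by move=> t _; rewrite lee_fin mulr_ge0 ?heat_prod_ge0 ?powR_ge0.
  - exact: measurable_potential_integrand.
  - apply: measurable_funeM.
    by apply: measurable_geo; exact: measurable_potential_integrand.
  move=> t; rewrite /= in_itv/= andbT => t0.
  rewrite -!EFinM lee_fin -/(gmean _ _ _) gmeanM ?heat_prod_ge0 ?powR_ge0//.
  rewrite gmean_powR// mulrA.
  (* The time powers combine exactly, since the weights [l] and [1 - l] add up to 1. *)
  have -> : l * (s1 - 1) + (1 - l) * (s2 - 1) = l * s1 + (1 - l) * s2 - 1 by ring.
  by rewrite ler_wpM2r ?powR_ge0// heat_prod_gmean.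
have ge0i (z : R) : 0 < z -> 0 <= z^-1 by move=> ?; rewrite invr_ge0 ltW.
rewrite gmean_poweR ?ge0i// gmeanV ?(ltW G1) ?(ltW G2)//.
apply: le_trans (lee_wpmul2l _ key) _; first by rewrite lee_fin ge0i.
rewrite !muleA -!EFinM -muleA -[leRHS]muleA /potential_const /gamma_ratio.
have /gt_eqF/negbT gm0 := gmean_gt0 l G1 G2; have /gt_eqF/negbT g0 := G.
rewrite le_eqVlt; apply/orP; left; apply/eqP; congr ((_%:E) * _)%E.
by field; apply/andP.
Qed.

End potential_kernels.

(** * The weighted spaces *)

Section weighted_spaces.
Context (R : realType) (d : nat).
Implicit Types (alpha beta gam x y : d.-tuple R) (l p q : R) (U V : weight R d).
Implicit Types (f : d.-tuple R -> R).
Local Notation M := (lebesgue_tuple R d).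
Local Notation O := (@orthant R d).

Let mO : measurable O := @measurable_orthant R d.

Lemma gmeanC l (a b : R) : gmean (1 - l) b a = gmean l a b.
Proof. by rewrite /gmean subKr mulrC. Qed.

(** Here [a] and [b] are the densities of the two given spaces and [c] is [|f|]: the factor
    [(b / a)^(1 - l)] turns [a] into [a^l b^(1 - l)]. *)
Lemma split_powR l p (a b c : R) : 0 < p -> 0 < a -> 0 < b -> 0 <= c ->
  (c * (b / a) `^ ((1 - l) / p)) `^ p * a = c `^ p * gmean l a b.
Proof.
move=> p0 a0 b0 c0; rewrite powRM ?powR_ge0// -powRrM divfK ?gt_eqF//.
rewrite -mulrA; congr (_ * _); rewrite powRM ?invr_ge0 ?ltW// -powR_inv1 ?ltW//.
rewrite -powRrM mulN1r opprB -[X in _ * X](powRr1 (ltW a0)) -mulrA -powRD.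
  by rewrite subrK mulrC.
by rewrite (gt_eqF a0) implybT.
Qed.

Lemma gmean_split l p (a b c : R) : 0 < p -> 0 < a -> 0 < b -> 0 <= c ->
  gmean l (c * (b / a) `^ ((1 - l) / p)) (c * (a / b) `^ (l / p)) = c.
Proof.
move=> p0 a0 b0 c0; rewrite gmeanM ?powR_ge0// gmean_id//.
rewrite /gmean -!powRrM -[a / b]invf_div -(@powR_inv1 _ (b / a)) ?divr_ge0 ?ltW//.
rewrite -powRrM -powRD; last by rewrite (gt_eqF (divr_gt0 b0 a0)) implybT.
rewrite (_ : _ + _ = 0); first by rewrite powRr0 mulr1.
by ring.
Qed.

Lemma power_weight_gt0 alpha x : O x -> 0 < power_weight alpha x.
Proof. by move=> ox; apply: prodr_gt0 => i _; rewrite powR_gt0. Qed.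

(** An equality, because the exponents [2 alpha_i + 1] are affine in [alpha]. *)
Lemma power_weight_gmean l beta gam x : O x ->
  power_weight (lconv_tuple l beta gam) x =
  gmean l (power_weight beta x) (power_weight gam x).
Proof.
move=> ox; rewrite /= gmean_prod; [|by move=> i; exact: powR_ge0..].
apply: eq_bigr => i _; rewrite gmean_powR// tnth_mktuple.
by congr (_ `^ _); ring.
Qed.

Definition density alpha U x : R := U x * power_weight alpha x.

Lemma density_ge0 alpha U x : O x -> 0 <= density alpha U x.
Proof. by move=> ox; rewrite mulr_ge0 ?weight_ge0. Qed.

Lemma measurable_density alpha U : measurable_fun O (density alpha U).
Proof. by apply: measurable_funM; exact: weight_measurable. Qed.

Lemma density_gmean l beta gam U1 U2 x : O x ->
  density (lconv_tuple l beta gam) (geo_weight l U1 U2) x =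
  gmean l (density beta U1 x) (density gam U2 x).
Proof.
move=> ox; rewrite gmeanM ?weight_ge0// /density power_weight_gmean//.
Qed.

Lemma density_gt0 alpha U : ae_positive U ->
  {ae M, forall x, O x -> 0 < density alpha U x}.
Proof.
apply: filterS => x Ux ox.
by rewrite mulr_gt0 ?Ux ?power_weight_gt0.
Qed.

Lemma integral_laguerre alpha (h : d.-tuple R -> \bar R) :
    measurable_fun O h -> (forall x, O x -> (0 <= h x)%E) ->
  (\int[laguerre_measure alpha]_(x in O) h x =
   \int[M]_(x in O) (h x * (power_weight alpha x)%:E))%E.
Proof. exact: integral_wmeasure. Qed.

Lemma integral_weighted alpha U (h : d.-tuple R -> \bar R) :
    measurable_fun setT h -> (forall x, 0 <= h x)%E ->
  (\int[wmeasure (laguerre_measure alpha) U]_x h x =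
   \int[M]_(x in O) (h x * (density alpha U x)%:E))%E.
Proof.
move=> mh h0; rewrite integral_wmeasureT// integral_laguerre.
- by apply: eq_integral => x _; rewrite -muleA.
- by apply: emeasurable_funM; [exact: measurable_funTS|exact: measurable_weight].
- by move=> x ox; rewrite mule_ge0// lee_fin weight_ge0.
Qed.

Lemma Lnorm_poweR alpha U q (F : d.-tuple R -> \bar R) : 0 < q ->
    measurable_fun setT F ->
  ('N[wmeasure (laguerre_measure alpha) U]_q%:E[F] `^ q =
   \int[M]_(x in O) (`|F x| `^ q * (density alpha U x)%:E))%E.
Proof.
move=> q0 mF; rewrite poweR_Lnorm ?gt_eqF// integral_weighted//.
- apply: (measurableT_comp (measurable_poweR _)); exact: measurableT_comp.
- by move=> x; exact: poweR_ge0.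
Qed.

(* With [(r, beta, gam) = (1 - l, beta, gam)] and [(l, gam, beta)] these are the
   factors [f1] and [f2] of [|f|]: the powers of the ratio of the densities cancel
   in [f1^l f2^(1-l)], and turn [f1^p] times the density of the first space into
   [|f|^p] times the density of the interpolated one. *)
Definition transfer p (r : R) beta gam U1 U2 f : d.-tuple R -> R :=
  (fun x => `|f x| * (density gam U2 x / density beta U1 x) `^ (r / p)) \_ O.

Lemma transfer_ge0 p r beta gam U1 U2 f x : 0 <= transfer p r beta gam U1 U2 f x.
Proof.
by rewrite /transfer patchE; case: ifP => // _; rewrite mulr_ge0 ?powR_ge0.
Qed.

Lemma transferE p (r : R) beta gam U1 U2 f x : O x ->
  transfer p r beta gam U1 U2 f x =
  `|f x| * (density gam U2 x / density beta U1 x) `^ (r / p).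
Proof. by move=> ox; rewrite /transfer patchE mem_set. Qed.

Lemma poweR_inj p (X Y : \bar R) : 0 < p -> (0 <= X)%E -> (0 <= Y)%E ->
  (X `^ p = Y `^ p)%E -> X = Y.
Proof.
move=> p0 X0 Y0 XY; rewrite -(poweRe1 X0) -(poweRe1 Y0).
by rewrite -(mulfV (negbT (gt_eqF p0))) !poweRrM XY.
Qed.

Lemma measurable_transfer p r beta gam U1 U2 f : measurable_fun setT f ->
  measurable_fun setT (transfer p r beta gam U1 U2 f).
Proof.
move=> mf; apply/(measurable_restrictT _ mO); apply: measurable_funM.
  by apply: measurableT_comp => //; exact: measurable_funTS.
apply: (measurableT_comp (measurable_powR _)); apply: measurable_funM.
  exact: measurable_density.
apply: measurableT_comp; [exact: measurable_invr|exact: measurable_density].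
Qed.

(** The densities are kept abstract so that both factors are served: for the second one, [beta] and
    [gam] are exchanged and [l] becomes [1 - l]. Positivity almost everywhere allows division by a
    density. *)
Lemma transfer_Lnorm l p alpha beta gam U U1 U2 f : 0 < p ->
    ae_positive U1 -> ae_positive U2 -> measurable_fun setT f ->
    (forall x, O x ->
      density alpha U x = gmean l (density beta U1 x) (density gam U2 x)) ->
  ('N[wmeasure (laguerre_measure beta) U1]_p%:E
     [EFin \o transfer p (1 - l) beta gam U1 U2 f] =
   'N[wmeasure (laguerre_measure alpha) U]_p%:E[EFin \o f])%E.
Proof.
move=> p0 U10 U20 mf densE.
have mt := measurable_transfer p (1 - l) beta gam U1 U2 mf.
apply: (poweR_inj p0); [exact: Lnorm_ge0|exact: Lnorm_ge0|].
rewrite (Lnorm_poweR _ _ p0); last exact/measurable_EFinP.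
rewrite (Lnorm_poweR _ _ p0); last exact/measurable_EFinP.
have mX (g : d.-tuple R -> R) (a : d.-tuple R) W : measurable_fun setT g ->
    measurable_fun O (fun x => `|(EFin \o g) x| `^ p * (density a W x)%:E)%E.
  move=> mg; apply: emeasurable_funM; last first.
    by apply/measurable_EFinP; exact: measurable_density.
  apply: measurable_funTS; apply: (measurableT_comp (measurable_poweR _)).
  by apply: measurableT_comp => //; exact/measurable_EFinP.
apply: ge0_ae_eq_integral => //; [exact: mX|exact: mX|..].
- by move=> x ox; rewrite mule_ge0 ?poweR_ge0// lee_fin density_ge0.
- by move=> x ox; rewrite mule_ge0 ?poweR_ge0// lee_fin density_ge0.
apply: filterS2 (density_gt0 beta U10) (density_gt0 gam U20) => x h1 h2 ox.
rewrite /= -!EFinM densE//; congr (_%:E).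
rewrite (ger0_norm (transfer_ge0 _ _ _ _ _ _ _ _)) transferE//.
exact: split_powR p0 (h1 ox) (h2 ox) (normr_ge0 _).
Qed.

Lemma gmean_transfer l p beta gam U1 U2 f : 0 < p ->
    ae_positive U1 -> ae_positive U2 ->
  {ae M, forall x, O x -> gmean l (transfer p (1 - l) beta gam U1 U2 f x)
                                 (transfer p l gam beta U2 U1 f x) = `|f x|}.
Proof.
move=> p0 U10 U20.
apply: filterS2 (density_gt0 beta U10) (density_gt0 gam U20) => x h1 h2 ox.
rewrite !transferE//; exact: gmean_split p0 (h1 ox) (h2 ox) (normr_ge0 _).
Qed.

Lemma LfunP (mu : {measure set (d.-tuple R) -> \bar R}) p f :
  f \in Lfun mu p%:E <->
  measurable_fun setT f /\ ('N[mu]_p%:E[EFin \o f] < +oo)%E.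
Proof.
split.
  by rewrite inE => /andP[]; rewrite !inE/=; split.
by move=> [mf foo]; rewrite inE; apply/andP; split; rewrite inE.
Qed.

End weighted_spaces.

(** * Geometric means of extended values *)

Lemma gmean_mule (R : realType) (l C a b w w1 w2 : R) (K K1 K2 : \bar R) :
    0 <= a -> 0 <= b -> 0 <= w1 -> 0 <= w2 -> (0 <= K1)%E -> (0 <= K2)%E ->
    w = gmean l w1 w2 -> (K <= C%:E * (K1 `^ l * K2 `^ (1 - l)))%E ->
  (K * (gmean l a b)%:E * w%:E <=
   C%:E * ((K1 * a%:E * w1%:E) `^ l * (K2 * b%:E * w2%:E) `^ (1 - l)))%E.
Proof.
move=> a0 b0 w10 w20 K10 K20 -> hK.
rewrite -!muleA -!EFinM -gmeanM// [(K * _)%E]muleC [(K1 * _)%E]muleC.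
rewrite [(K2 * _)%E]muleC gmean_poweR ?mulr_ge0// muleCA lee_wpmul2l//.
by rewrite lee_fin gmean_ge0.
Qed.

Lemma gmean_poweR_le (R : realType) (l q D : R) (X X1 X2 : \bar R) :
    0 < q -> 0 <= D -> (0 <= X)%E ->
    (X `^ q <= (D `^ q)%:E * ((X1 `^ q) `^ l * (X2 `^ q) `^ (1 - l)))%E ->
  (X <= D%:E * (X1 `^ l * X2 `^ (1 - l)))%E.
Proof.
move=> q0 D0 X0.
have R0 : (0 <= D%:E * (X1 `^ l * X2 `^ (1 - l)))%E.
  by rewrite mule_ge0 ?lee_fin// mule_ge0// poweR_ge0.
have -> : ((D `^ q)%:E * ((X1 `^ q) `^ l * (X2 `^ q) `^ (1 - l)) =
    (D%:E * (X1 `^ l * X2 `^ (1 - l))) `^ q)%E.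
  rewrite poweRM ?lee_fin// ?mule_ge0 ?poweR_ge0// poweRM ?poweR_ge0//.
  by rewrite (poweRAC X1) (poweRAC X2) poweR_EFin.
have qi : 0 <= q^-1 by rewrite invr_ge0 ltW.
move=> /(gt0_ler_poweR qi); rewrite -!poweRrM mulfV ?gt_eqF// !poweRe1//; apply;
  by rewrite in_itv/= leey andbT poweR_ge0.
Qed.

(** [C1] and [C2] come from [bounded_operator], which does not fix their signs; hence the absolute
    values in the mean of the constants. *)
Lemma gmean_bound (R : realType) (l C1 C2 D : R) (X1 X2 n : \bar R) :
    0 < l < 1 -> 0 <= D -> (0 <= X1)%E -> (0 <= X2)%E -> (0 <= n)%E ->
    (n < +oo)%E -> (X1 <= C1%:E * n)%E -> (X2 <= C2%:E * n)%E ->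
  (D%:E * (X1 `^ l * X2 `^ (1 - l)) <= (D * gmean l `|C1| `|C2|)%:E * n)%E.
Proof.
move=> /andP[l0 l1] D0 X10 X20; case: n => [n| |]//.
rewrite lee_fin => n0 _ B1 B2.
have leC (C : R) (X : \bar R) : (X <= C%:E * n%:E)%E -> (X <= (`|C| * n)%:E)%E.
  by move=> /le_trans; apply; rewrite -EFinM lee_fin ler_wpM2r// ler_norm.
have mono (r : R) (X Y : \bar R) : 0 <= r -> (0 <= X)%E -> (X <= Y)%E ->
    (X `^ r <= Y `^ r)%E.
  move=> r0 X0 XY; apply: gt0_ler_poweR => //; rewrite in_itv/= leey andbT//.
  exact: le_trans XY.
have -> : ((D * gmean l `|C1| `|C2|)%:E * n%:E =
    D%:E * ((`|C1| * n)%:E `^ l * (`|C2| * n)%:E `^ (1 - l)))%E.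
  rewrite !poweR_EFin -!EFinM; congr (_%:E); rewrite -/(gmean _ _ _).
  rewrite (gmeanM _ (normr_ge0 C1) (normr_ge0 C2) n0 n0) (gmean_id _ n0).
  by rewrite [RHS]mulrA.
rewrite lee_wpmul2l ?lee_fin//; apply: lee_pmul; rewrite ?poweR_ge0//.
- by apply: mono; rewrite ?(ltW l0)//; exact: leC.
- by apply: mono; rewrite ?subr_ge0 ?(ltW l1)//; exact: leC.
Qed.

(** * Pointwise bound for the potential operators *)

Section potential_operators.
Context (R : realType) (d : nat).
Implicit Types (alpha beta gam x y : d.-tuple R) (l p q s : R) (U V : weight R d).
Implicit Types (f : d.-tuple R -> R).
Local Notation M := (lebesgue_tuple R d).
Local Notation O := (@orthant R d).

Let mO : measurable O := @measurable_orthant R d.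

(** The density, extended by [0] off the orthant, is moved into the integrand, so that Tonelli's
    theorem is applied with the sigma-finite Lebesgue measure. *)
Lemma measurable_integral_laguerre alpha (H : d.-tuple R * d.-tuple R -> \bar R) :
    measurable_fun setT H -> (forall z, 0 <= H z)%E ->
  measurable_fun setT (fun x => \int[laguerre_measure alpha]_(y in O) H (x, y))%E.
Proof.
move=> mH H0; pose w : d.-tuple R -> \bar R := (EFin \o power_weight alpha) \_ O.
have mw : measurable_fun setT w.
  by apply/(measurable_restrictT _ mO); exact: measurable_weight.
have w0 y : (0 <= w y)%E.
  by rewrite /w patchE; case: ifPn => // /set_mem oy; rewrite lee_fin weight_ge0.
pose H' (z : d.-tuple R * d.-tuple R) := (H z * w z.2)%E.
rewrite (_ : (fun x => _) = fubini_F M H').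
  apply: measurable_fun_fubini_tonelli_F.
    by apply: emeasurable_funM => //; exact: measurableT_comp measurable_snd.
  by move=> z; rewrite mule_ge0.
apply/funext => x; rewrite integral_laguerre//.
  rewrite integral_mkcond; apply: eq_integral => y _.
  rewrite /H' /w !patchE/=; case: ifP => // _.
  by rewrite mule0.
by apply: measurable_funTS; exact: measurable_fun_pair2.
Qed.

Lemma measurable_kernel_fun alpha s f x : (forall i, -1 < tnth alpha i) ->
  measurable_fun setT f ->
  measurable_fun setT (fun y => potential_kernel alpha s x y * (f y)%:E)%E.
Proof.
move=> a1 mf; apply: emeasurable_funM; last exact/measurable_EFinP.
exact: (measurable_fun_pair2 x (measurable_potential_kernel s a1)).
Qed.

Lemma measurable_potential alpha s f : (forall i, -1 < tnth alpha i) ->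
  measurable_fun setT f -> measurable_fun setT (potential alpha s f).
Proof.
move=> a1 mf; pose G (z : d.-tuple R * d.-tuple R) : \bar R :=
  (potential_kernel alpha s z.1 z.2 * (f z.2)%:E)%E.
have mG : measurable_fun setT G.
  apply: emeasurable_funM; first exact: measurable_potential_kernel.
  by apply/measurable_EFinP; exact: measurableT_comp measurable_snd.
rewrite (_ : potential alpha s f = fun x =>
  (\int[laguerre_measure alpha]_(y in O) G^\+ (x, y) -
   \int[laguerre_measure alpha]_(y in O) G^\- (x, y))%E).
  apply: emeasurable_funB; apply: measurable_integral_laguerre => //.
    exact: measurable_funepos.
  exact: measurable_funeneg.
apply/funext => x; rewrite /potential integralE; congr (_ - _)%E.
  by apply: eq_integral => y _; rewrite !funeposE.
by apply: eq_integral => y _; rewrite !funenegE.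
Qed.

(** All three integrals are rewritten over Lebesgue measure. There the kernel is bounded by a
    geometric mean, [|f|] and the power weight equal one, and [geo_hoelder] applies to the
    product. *)
Lemma potential_gmean l s1 s2 beta gam f f1 f2 x : 0 < l < 1 ->
    (forall i, -1 < tnth beta i) -> (forall i, -1 < tnth gam i) ->
    0 < s1 -> 0 < s2 ->
    measurable_fun setT f -> measurable_fun setT f1 -> measurable_fun setT f2 ->
    (forall y, 0 <= f1 y) -> (forall y, 0 <= f2 y) ->
    {ae M, forall y, O y -> gmean l (f1 y) (f2 y) = `|f y|} ->
  (\int[laguerre_measure (lconv_tuple l beta gam)]_(y in O)
     (potential_kernel (lconv_tuple l beta gam) (l * s1 + (1 - l) * s2) x y *
      `|f y|%:E) <=
   (potential_const l beta gam s1 s2)%:E *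
   (potential beta s1 f1 x `^ l * potential gam s2 f2 x `^ (1 - l)))%E.
Proof.
move=> l01 b1 g1 s10 s20 mf mf1 mf2 f10 f20 fE.
have a1 := lconv_tuple_gtN1 l01 b1 g1; have s0 := lconv_gt0 l01 s10 s20.
set alpha := lconv_tuple l beta gam in a1 *; set s := (l * s1 + _)%R in s0 *.
set C := potential_const l beta gam s1 s2.
have C0 : 0 <= C by exact: potential_const_ge0.
have mgm : measurable_fun setT (fun y => gmean l (f1 y) (f2 y)).
  by apply: measurable_funM; exact: (measurableT_comp (measurable_powR _)).
have mnf : measurable_fun setT (fun y => `|f y|) by exact: measurableT_comp.
have pk0 a t y : (forall i, -1 < tnth a i) -> 0 < t ->
  (0 <= potential_kernel a t x y)%E by exact: potential_kernel_ge0.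
have mpw a : measurable_fun O (fun y => (power_weight a y)%:E).
  exact: measurable_weight.
have pw0 a y : O y -> (0 <= (power_weight a y)%:E)%E by exact: weightE_ge0.
have mK a t (g : d.-tuple R -> R) : (forall i, -1 < tnth a i) ->
    measurable_fun setT g ->
    measurable_fun O (fun y => potential_kernel a t x y * (g y)%:E)%E.
  by move=> a1' mg; apply: measurable_funTS; exact: measurable_kernel_fun.
have mKw a t (g : d.-tuple R -> R) : (forall i, -1 < tnth a i) ->
    measurable_fun setT g -> measurable_fun O (fun y =>
      potential_kernel a t x y * (g y)%:E * (power_weight a y)%:E)%E.
  by move=> a1' mg; apply: emeasurable_funM => //; exact: mK.
have Kw0 a t (g : d.-tuple R -> R) y : (forall i, -1 < tnth a i) -> 0 < t ->
    (forall y, 0 <= g y) -> O y ->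
    (0 <= potential_kernel a t x y * (g y)%:E * (power_weight a y)%:E)%E.
  move=> a1' t0 g0 oy; apply: mule_ge0; last exact: pw0.
  by apply: mule_ge0; [exact: pk0|rewrite lee_fin].
rewrite /potential !integral_laguerre; last 6 first.
- exact: mK.
- by move=> y oy; apply: mule_ge0; [exact: pk0|rewrite lee_fin].
- exact: mK.
- by move=> y oy; apply: mule_ge0; [exact: pk0|rewrite lee_fin].
- exact: mK.
- by move=> y oy; apply: mule_ge0; [exact: pk0|rewrite lee_fin].
(* [|f|] is the geometric mean of [f1] and [f2] only almost everywhere, hence a replacement under
   the integral. *)
rewrite (@ge0_ae_eq_integral _ _ _ M O _ (fun y => potential_kernel alpha s x y *
  (gmean l (f1 y) (f2 y))%:E * (power_weight alpha y)%:E)%E mO); last 5 first.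
- exact: mKw.
- exact: mKw.
- by move=> y oy; exact: (Kw0 alpha s (fun z => `|f z|)).
- move=> y oy; apply: (Kw0 alpha s (fun z => gmean l (f1 z) (f2 z))) => // z.
  exact: gmean_ge0.
- by apply: filterS fE => y fEy oy; rewrite fEy.
have h := @geo_hoelder R _ _ M O _ _ l mO l01 (mKw beta s1 f1 b1 mf1)
  (mKw gam s2 f2 g1 mf2).
apply: le_trans (lee_wpmul2l _ (h _ _)); last first.
- by move=> y oy; exact: (Kw0 gam s2 f2).
- by move=> y oy; exact: (Kw0 beta s1 f1).
- by rewrite lee_fin.
rewrite -ge0_integralZl//; last 2 first.
- by apply: measurable_geo; exact: mKw.
- by move=> y oy; rewrite mule_ge0// poweR_ge0.
apply: ge0_le_integral => //.
- move=> y oy; apply: (Kw0 alpha s (fun z => gmean l (f1 z) (f2 z))) => // z.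
  exact: gmean_ge0.
- exact: mKw.
- by apply: measurable_funeM; apply: measurable_geo; exact: mKw.
move=> y oy.
apply: gmean_mule; rewrite ?weight_ge0 ?pk0//; first exact: power_weight_gmean.
exact: potential_kernel_gmean.
Qed.

End potential_operators.

(** * Norm bound and interpolation *)

Section interpolation.
Context (R : realType) (d : nat).
Implicit Types (alpha beta gam x y : d.-tuple R) (l p q s : R) (U V : weight R d).
Local Notation M := (lebesgue_tuple R d).
Local Notation O := (@orthant R d).

Let mO : measurable O := @measurable_orthant R d.

(** Raised to the power [q], the three norms become Lebesgue integrals and Hoelder's inequality in
    [x] applies; [gmean_poweR_le] takes the root. *)
Lemma Lnorm_potential_gmean l q D alpha beta gam V V1 V2
    (F F1 F2 : d.-tuple R -> \bar R) : 0 < l < 1 -> 0 < q -> 0 <= D ->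
    measurable_fun setT F -> measurable_fun setT F1 -> measurable_fun setT F2 ->
    (forall x, O x ->
      density alpha V x = gmean l (density beta V1 x) (density gam V2 x)) ->
    (forall x, 0 <= F1 x)%E -> (forall x, 0 <= F2 x)%E ->
    (forall x, `|F x| <= D%:E * (F1 x `^ l * F2 x `^ (1 - l)))%E ->
  ('N[wmeasure (laguerre_measure alpha) V]_q%:E[F] <=
   D%:E * ('N[wmeasure (laguerre_measure beta) V1]_q%:E[F1] `^ l *
           'N[wmeasure (laguerre_measure gam) V2]_q%:E[F2] `^ (1 - l)))%E.
Proof.
move=> l01 q0 D0 mF mF1 mF2 densE F10 F20 FD.
apply: (gmean_poweR_le q0 D0); first exact: Lnorm_ge0.
rewrite (Lnorm_poweR alpha V q0 mF) (Lnorm_poweR beta V1 q0 mF1).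
rewrite (Lnorm_poweR gam V2 q0 mF2).
have mX a W (G : d.-tuple R -> \bar R) : measurable_fun setT G ->
    measurable_fun O (fun x => `|G x| `^ q * (density a W x)%:E)%E.
  move=> mG; apply: emeasurable_funM; last first.
    by apply/measurable_EFinP; exact: measurable_density.
  apply: measurable_funTS; apply: (measurableT_comp (measurable_poweR _)).
  exact: measurableT_comp.
have X0 a W (G : d.-tuple R -> \bar R) x : O x ->
    (0 <= `|G x| `^ q * (density a W x)%:E)%E.
  by move=> ox; rewrite mule_ge0 ?poweR_ge0// lee_fin density_ge0.
have Dq0 : 0 <= D `^ q by exact: powR_ge0.
have h := @geo_hoelder R _ _ M O _ _ l mO l01 (mX beta V1 F1 mF1) (mX gam V2 F2 mF2).
apply: le_trans (lee_wpmul2l _ (h _ _)); last first.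
- by move=> x ox; exact: X0.
- by move=> x ox; exact: X0.
- by rewrite lee_fin.
rewrite -ge0_integralZl//; last 2 first.
- by apply: measurable_geo; exact: mX.
- by move=> x ox; rewrite mule_ge0// poweR_ge0.
apply: ge0_le_integral => //.
- by move=> x ox; exact: X0.
- exact: mX.
- by apply: measurable_funeM; apply: measurable_geo; exact: mX.
move=> x ox; rewrite densE// (gee0_abs (F10 x)) (gee0_abs (F20 x)).
rewrite [(`|F x| `^ q * _)%E]muleC [(F1 x `^ q * _)%E]muleC [(F2 x `^ q * _)%E]muleC.
rewrite gmean_poweR ?density_ge0 ?poweR_ge0// muleCA.
rewrite lee_wpmul2l ?lee_fin ?gmean_ge0//.
have Fx := FD x; have qge0 := ltW q0.
have R0 : (0 <= D%:E * (F1 x `^ l * F2 x `^ (1 - l)))%E.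
  by rewrite mule_ge0 ?lee_fin// mule_ge0// poweR_ge0.
apply: (@le_trans _ _ ((D%:E * (F1 x `^ l * F2 x `^ (1 - l))) `^ q)%E).
  by apply: gt0_ler_poweR => //; rewrite in_itv/= leey andbT.
rewrite poweRM ?lee_fin// ?mule_ge0 ?poweR_ge0// poweRM ?poweR_ge0//.
by rewrite (poweRAC (F1 x)) (poweRAC (F2 x)) poweR_EFin.
Qed.

Lemma bounded_potential_gmean l beta gam s1 s2 p q U1 U2 V1 V2 :
    (forall i, -1 < tnth beta i) -> (forall i, -1 < tnth gam i) ->
    0 < s1 -> 0 < s2 -> 1 <= p -> 1 <= q ->
    ae_positive U1 -> ae_positive U2 -> 0 < l < 1 ->
    bounded_potential beta s1 p q U1 V1 -> bounded_potential gam s2 p q U2 V2 ->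
  bounded_potential (lconv_tuple l beta gam) (l * s1 + (1 - l) * s2) p q
    (geo_weight l U1 U2) (geo_weight l V1 V2).
Proof.
move=> b1 g1 s10 s20 p1 q1 U10 U20 l01 [dom1 [C1 bd1]] [dom2 [C2 bd2]].
have p0 : 0 < p := lt_le_trans ltr01 p1; have q0 : 0 < q := lt_le_trans ltr01 q1.
have a1 := lconv_tuple_gtN1 l01 b1 g1; have s0 := lconv_gt0 l01 s10 s20.
set alpha := lconv_tuple l beta gam in a1 *; set s := (l * s1 + _)%R in s0 *.
pose D := potential_const l beta gam s1 s2.
have D0 : 0 <= D by exact: potential_const_ge0.
pose T1 := transfer p (1 - l) beta gam U1 U2.
pose T2 := transfer p l gam beta U2 U1.
set mX := wmeasure (laguerre_measure alpha) (geo_weight l U1 U2).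
have N1 f : measurable_fun setT f ->
    ('N[wmeasure (laguerre_measure beta) U1]_p%:E[EFin \o T1 f] =
     'N[mX]_p%:E[EFin \o f])%E.
  move=> mf; apply: transfer_Lnorm => // x ox; exact: density_gmean.
have N2 f : measurable_fun setT f ->
    ('N[wmeasure (laguerre_measure gam) U2]_p%:E[EFin \o T2 f] =
     'N[mX]_p%:E[EFin \o f])%E.
  (* [l] is written as [1 - (1 - l)] to use [transfer_Lnorm] with the two spaces exchanged. *)
  move=> mf; rewrite /T2 -{1}[l](subKr 1).
  by apply: transfer_Lnorm => // x ox; rewrite gmeanC; exact: density_gmean.
have L1 f : f \in Lfun mX p%:E ->
    T1 f \in Lfun (wmeasure (laguerre_measure beta) U1) p%:E.
  move=> /LfunP[mf foo]; apply/LfunP; split; first exact: measurable_transfer.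
  by rewrite N1.
have L2 f : f \in Lfun mX p%:E ->
    T2 f \in Lfun (wmeasure (laguerre_measure gam) U2) p%:E.
  move=> /LfunP[mf foo]; apply/LfunP; split; first exact: measurable_transfer.
  by rewrite N2.
have absE f x y : `|potential_kernel alpha s x y * (f y)%:E|%E =
    (potential_kernel alpha s x y * `|f y|%:E)%E.
  by rewrite abseM gee0_abs// potential_kernel_ge0.
have T10 f x : (0 <= potential beta s1 (T1 f) x)%E.
  apply: integral_ge0 => y _; rewrite mule_ge0 ?potential_kernel_ge0//.
  by rewrite lee_fin transfer_ge0.
have T20 f x : (0 <= potential gam s2 (T2 f) x)%E.
  apply: integral_ge0 => y _; rewrite mule_ge0 ?potential_kernel_ge0//.
  by rewrite lee_fin transfer_ge0.
(* Bounding the integral of absolute values yields both membership in the natural domain and the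
   norm estimate. *)
have key f x : measurable_fun setT f ->
    (\int[laguerre_measure alpha]_(y in O)
       `|potential_kernel alpha s x y * (f y)%:E| <=
     D%:E * (potential beta s1 (T1 f) x `^ l *
             potential gam s2 (T2 f) x `^ (1 - l)))%E.
  move=> mf; under eq_integral do rewrite absE.
  apply: potential_gmean => //; try exact: measurable_transfer.
  - by move=> y; exact: transfer_ge0.
  - by move=> y; exact: transfer_ge0.
  - exact: gmean_transfer.
have fin_of a t (g : d.-tuple R -> R) x : (forall i, -1 < tnth a i) -> 0 < t ->
    (forall y, 0 <= g y) ->
    (laguerre_measure a).-integrable O
      (fun y => potential_kernel a t x y * (g y)%:E)%E ->
    potential a t g x \is a fin_num.
  by move=> a1' t0 g0 ig; exact: integrable_fin_num.
split=> [f /= fL|].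
  have [mf _] := (LfunP _ _ _).1 fL.
  (* For almost every [x] the potentials of both factors are finite, and [key] transfers this to
     [f]. *)
  apply: filterS2 (dom1 _ (L1 _ fL)) (dom2 _ (L2 _ fL)) => x i1 i2 ox.
  apply/integrableP; split.
    by apply: measurable_funTS; exact: measurable_kernel_fun.
  apply: le_lt_trans (key f x mf) _; rewrite ltey_eq; apply/orP; left.
  rewrite fin_numM// fin_numM// fin_num_poweR//.
    by apply: fin_of (i1 ox) => // y; exact: transfer_ge0.
  by apply: fin_of (i2 ox) => // y; exact: transfer_ge0.
exists (D * gmean l `|C1| `|C2|) => f fL.
have [mf foo] := (LfunP _ _ _).1 fL.
have mTf : measurable_fun setT (potential alpha s f) by exact: measurable_potential.
split; first exact: measurable_funTS.
have mT1 := measurable_transfer p (1 - l) beta gam U1 U2 mf.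
have mT2 := measurable_transfer p l gam beta U2 U1 mf.
have hN := @Lnorm_potential_gmean l q D alpha beta gam (geo_weight l V1 V2) V1 V2
  (potential alpha s f) (potential beta s1 (T1 f)) (potential gam s2 (T2 f))
  l01 q0 D0 mTf (measurable_potential s1 b1 mT1) (measurable_potential s2 g1 mT2)
  (fun x => @density_gmean _ _ _ _ _ _ _ _) (T10 f) (T20 f).
apply: le_trans (hN _) _.
  move=> x; apply: le_trans (key f x mf); apply: le_abse_integral => //.
  by apply: measurable_funTS; exact: measurable_kernel_fun.
have [_ B1] := bd1 _ (L1 _ fL); have [_ B2] := bd2 _ (L2 _ fL).
rewrite N1// in B1; rewrite N2// in B2.
apply: gmean_bound B1 B2 => //; exact: Lnorm_ge0.
Qed.

End interpolation.

Theorem theorem5p2 (R : realType) (d : nat) (beta gam : d.-tuple R)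
  (sigma1 sigma2 p q lambda : R) (U1 U2 V1 V2 : weight R d) :
  (1 <= d)%N ->
  (forall i, -1 < tnth beta i) -> (forall i, -1 < tnth gam i) ->
  beta != gam ->
  0 < sigma1 -> 0 < sigma2 ->
  1 <= p -> 1 <= q ->
  ae_positive U1 -> ae_positive U2 -> ae_positive V1 -> ae_positive V2 ->
  0 < lambda < 1 ->
  let alpha :=
    [tuple lambda * tnth beta i + (1 - lambda) * tnth gam i | i < d] in
  let sigma := lambda * sigma1 + (1 - lambda) * sigma2 in
  let U := geo_weight lambda U1 U2 in
  let V := geo_weight lambda V1 V2 in
  bounded_potential beta sigma1 p q U1 V1 ->
  bounded_potential gam sigma2 p q U2 V2 ->
  bounded_potential alpha sigma p q U V.
Proof.
move=> _ beta1 gam1 _ sigma10 sigma20 p1 q1 U10 U20 _ _ lambda01 alpha sigma U V.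
exact: bounded_potential_gmean.
Qed.
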